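(* Let $K$ be a compact convex set with nonempty interior in $\mathbb{H}^2$ (curvature $-1$), and let $O\in\mathbb{H}^2$. Represent $\mathbb{H}^2$ by the Beltrami–Klein model with $O$ at the center, and for each $\varphi$ let $\lambda_1(\varphi)$ be the right-hand support line of $K$ through the ideal point $R(\varphi)$ and $r(\varphi)$ the signed hyperbolic distance from $O$ to $\lambda_1(\varphi)$. Then $$\mathcal{P}=\int_0^{2\pi}\sinh r(\varphi)\,d\varphi .$$
   Context: Beltrami–Klein model: open unit disk $D$ with the Hilbert metric $h(P,Q)=\frac12\log\!\left(\frac{|AQ|}{|AP|}\frac{|BP|}{|BQ|}\right)$, $A,B$ the points where the Euclidean line $PQ$ meets the unit circle, in order $A,P,Q,B$. $R(\varphi)=(\cos\varphi,\sin\varphi)$, $e(\varphi)=(-\sin\varphi,\cos\varphi)$; for $X\in D$, $\psi_X(\varphi)\in(0,\pi)$ is the counterclockwise angle from $e(\varphi)$ to $X-R(\varphi)$, and $\psi_1(\varphi)=\min_{X\in K}\psi_X(\varphi)$. The right-hand support line $\lambda_1(\varphi)$ is the line through $R(\varphi)$ at counterclockwise angle $\psi_1(\varphi)$ from $e(\varphi)$. The sign of $r(\varphi)$ is positive if $O$ lies in the open half-plane bounded by $\lambda_1(\varphi)$ that contains the interior of $K$, negative if $O$ lies in the other open half-plane, and $r=0$ if $O\in\lambda_1(\varphi)$. $\mathcal{P}$ is the hyperbolic length of $\partial K$. *)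

(* Defs.v *)
From HB Require Import structures.
From mathcomp Require Import all_boot all_order all_algebra.
From mathcomp Require Import all_classical all_reals all_analysis.
Set Implicit Arguments. Unset Strict Implicit. Unset Printing Implicit Defensive.
Import Order.TTheory GRing.Theory Num.Theory numFieldNormedType.Exports.
Local Open Scope classical_set_scope.
Local Open Scope ring_scope.

Section Defs.
Variable R : realType.
Notation pt := (R * R)%type.

Definition padd (P Q : pt) : pt := (P.1 + Q.1, P.2 + Q.2).
Definition psub (P Q : pt) : pt := (P.1 - Q.1, P.2 - Q.2).
Definition pscale (t : R) (P : pt) : pt := (t * P.1, t * P.2).
Definition dot (P Q : pt) : R := P.1 * Q.1 + P.2 * Q.2.
Definition cross (P Q : pt) : R := P.1 * Q.2 - P.2 * Q.1.
Definition enorm (P : pt) : R := Num.sqrt (dot P P).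
Definition edist (P Q : pt) : R := enorm (psub Q P).

Definition diskD : set pt := [set P | dot P P < 1].

(* the points A, B where the Euclidean line PQ meets the unit circle, in
   the order A, P, Q, B: A = P + tA (Q - P), B = P + tB (Q - P), where
   tA < 0 < 1 < tB are the two roots of |P + t (Q - P)|^2 = 1. *)
Definition qa (P Q : pt) : R := dot (psub Q P) (psub Q P).
Definition qb (P Q : pt) : R := 2 * dot P (psub Q P).
Definition qc (P Q : pt) : R := dot P P - 1.
Definition qdisc (P Q : pt) : R := qb P Q ^+ 2 - 4 * qa P Q * qc P Q.
Definition ideal_A (P Q : pt) : pt :=
  padd P (pscale ((- qb P Q - Num.sqrt (qdisc P Q)) / (2 * qa P Q)) (psub Q P)).
Definition ideal_B (P Q : pt) : pt :=
  padd P (pscale ((- qb P Q + Num.sqrt (qdisc P Q)) / (2 * qa P Q)) (psub Q P)).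

(* Hilbert metric of the Beltrami--Klein model *)
Definition hdist (P Q : pt) : R :=
  if P == Q then 0 else
  (1 / 2) * ln ((edist (ideal_A P Q) Q / edist (ideal_A P Q) P)
               * (edist (ideal_B P Q) P / edist (ideal_B P Q) Q)).

Definition Rpt (phi : R) : pt := (cos phi, sin phi).
Definition ept (phi : R) : pt := (- sin phi, cos phi).

Definition ccw_angle (u v : pt) : R :=
  let a := acos (dot u v / (enorm u * enorm v)) in
  if 0 <= cross u v then a else 2 * pi - a.

Definition psi (X : pt) (phi : R) : R := ccw_angle (ept phi) (psub X (Rpt phi)).

Definition psi1 (K : set pt) (phi : R) : R := inf [set psi X phi | X in K].

(* direction of the right-hand support line lambda_1(phi): e(phi) rotated
   counterclockwise by psi1(phi) *)
Definition lam_dir (K : set pt) (phi : R) : pt :=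
  let a := psi1 K phi in
  padd (pscale (cos a) (ept phi)) (pscale (sin a) (psub (0, 0) (Rpt phi))).

Definition lambda1 (K : set pt) (phi : R) : set pt :=
  [set X | exists t : R, X = padd (Rpt phi) (pscale t (lam_dir K phi))].

Definition side (K : set pt) (phi : R) (X : pt) : R :=
  cross (lam_dir K phi) (psub X (Rpt phi)).

Definition hdist_O_line (K : set pt) (phi : R) : R :=
  inf [set hdist (0, 0) X | X in lambda1 K phi `&` diskD].

Definition r_signed (K : set pt) (phi : R) : R :=
  let sO := side K phi (0, 0) in
  if sO == 0 then 0
  else if `[< forall X, (interior K) X -> 0 < sO * side K phi X >]
       then hdist_O_line K phi
       else - hdist_O_line K phi.

Definition sinh (x : R) : R := (expR x - expR (- x)) / 2.

Definition boundary (K : set pt) : set pt := closure K `\` interior K.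

Definition param_boundary (K : set pt) (gamma : R -> pt) : Prop :=
  {within `[0, 1], continuous gamma} /\ gamma 0 = gamma 1 /\
  {in `[0, 1[ &, injective gamma} /\ gamma @` `[0, 1] = boundary K.

Definition hlength (gamma : R -> pt) : \bar R :=
  ereal_sup [set x : \bar R | exists (n : nat) (t : nat -> R),
     [/\ t 0%N = 0, t n = 1, (forall i, (i < n)%N -> t i < t i.+1) &
          x = (\sum_(i < n) hdist (gamma (t i)) (gamma (t i.+1)))%:E]].
End Defs.

(* Main.v *)
Require Import Defs.
From HB Require Import structures.
From mathcomp Require Import all_boot all_order all_algebra.
From mathcomp Require Import all_classical all_reals all_analysis.
From mathcomp Require Import ring lra.
Import Order.TTheory GRing.Theory Num.Theory numFieldNormedType.Exports.
Local Open Scope classical_set_scope.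
Local Open Scope ring_scope.

(* For X in the disk put f_X(phi) = (e.X) / (1 - R.X) = cot psi_X(phi), the
   phi-derivative of -ln(1 - R.X).  Then sinh r = max_K f_X.  Splitting the
   circle at the two ideal endpoints of PQ gives the Crofton formula
   int |f_P - f_Q| dphi = 4 h(P, Q).  For a fixed phi, convexity makes each
   value of f be taken at most twice along the boundary, so the chord sums of
   |f_P - f_Q| are at most 2 (max f - min f), with equality in the limit of
   fine subdivisions.  Hence 4 P = 2 int (max f - min f).  Finally, the
   right-hand support line through R(phi) is the left-hand one through its
   other ideal endpoint, whence int min f = - int max f. *)

(** The delicate step is the last one. Formally it is the substitution y = x + pi - 2 atan M(x),
    where M is the maximum over K and the minimum at y is -M(x): the factor 1 - 2M'/(1 + M^2) leaves
    the extra term 2MM'/(1 + M^2), the derivative of ln(1 + M^2), which integrates to 0 over a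
    period. But M is only Lipschitz, with possible corners where the maximizing point jumps. So the
    substitution is replaced by a function made of primitives whose derivative is 0 everywhere: M
    enters it through a combination that is stationary to first order, and a Lipschitz bound then
    suffices. The length is a supremum of chord sums, so it is compared with the width integral by
    two inequalities between integrands. The upper one holds for every subdivision and every phi;
    the lower one, up to an error e, needs one subdivision that serves all phi at once, hence
    estimates uniform in phi. They come from compactness, which keeps K away from the unit circle.
    Counting values fails at the extreme levels, where a support line may contain a boundary
    segment; only levels strictly between the extremes are counted. *)

(** * One-variable calculus: Lipschitz bounds, first-order expansions, primitives *)

Section Calculus.
Context {R : realType}.
Implicit Types (f g h : R -> R) (a b x y : R).
Notation mu := (@lebesgue_measure R).

Lemma lipschitz_continuous f (C : R) :
  (forall x y, `|f x - f y| <= C * `|x - y|) -> continuous f.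
Proof.
move=> fC x; apply/cvgrPdist_lt => e e0.
have C0 : 0 < `|C| + 1 by rewrite ltr_pwDr.
near=> y.
rewrite (le_lt_trans (fC _ _))// (@le_lt_trans _ _ ((`|C| + 1) * `|x - y|))//.
  by rewrite ler_wpM2r// (le_trans (ler_norm _))// lerDl.
rewrite -ltr_pdivlMl//; near: y.
by apply: cvgr_dist_lt => //; rewrite mulr_gt0 ?invr_gt0.
Unshelve. all: by end_near. Qed.

Lemma is_derive_continuous f (df : R -> R) :
  (forall x, is_derive x 1 f (df x)) -> continuous f.
Proof.
by move=> fdf x; apply/differentiable_continuous/derivable1_diffP; have [] := fdf x.
Qed.

Lemma bounded_derive_lipschitz f (df : R -> R) (C : R) :
  (forall x, is_derive x 1 f (df x)) -> (forall x, `|df x| <= C) ->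
  forall x y, `|f x - f y| <= C * `|x - y|.
Proof.
move=> fdf dfC x y.
wlog xy : x y / x <= y.
  by move=> H; have [/H//|/ltW/H] := leP x y; rewrite distrC (distrC y).
have cf := is_derive_continuous f df fdf.
have [|c _ E] := @MVT_segment R f df x y xy (fun z _ => fdf z).
  exact: continuous_subspaceT.
by rewrite distrC E normrM (distrC x) ler_wpM2r.
Qed.

Lemma is_derive_expand f (x l : R) : is_derive x 1 f l ->
  forall e, 0 < e -> exists2 d, 0 < d & forall y, `|y - x| < d ->
    `|f y - f x - l * (y - x)| <= e * `|y - x|.
Proof.
case=> dv lv e e0.
have : h^-1 *: (f (h *: 1 + x) - f x) @[h --> (0 : R)^'] --> l by rewrite -lv.
move=> /cvgrPdist_le /(_ _ e0) /nbhs_ballP[d d0 H]; exists d => // y yxd.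
have [->|yx] := eqVneq y x; first by rewrite !subrr mulr0 subrr normr0 mulr0.
have := H (y - x); rewrite /ball/= sub0r normrN => /(_ yxd).
rewrite subr_eq0 => /(_ yx).
rewrite [_ *: 1]mulr1 subrK => Hle.
have yx0 : y - x != 0 by rewrite subr_eq0.
have -> : f y - f x - l * (y - x) = ((y - x)^-1 * (f y - f x) - l) * (y - x).
  by field.
by rewrite normrM ler_wpM2r// distrC.
Qed.

(** Serves for a sum whose terms need not be differentiable one by one, so that the rules of
    differentiation do not apply to it. *)
Lemma expand_is_derive f (x l : R) :
  (forall e, 0 < e -> exists2 d, 0 < d & forall y, `|y - x| < d ->
    `|f y - f x - l * (y - x)| <= e * `|y - x|) -> is_derive x 1 f l.
Proof.
move=> H.
have L : h^-1 *: (f (h *: 1 + x) - f x) @[h --> (0:R)^'] --> l.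
  apply/cvgrPdist_le => e e0; have [d d0 Hd] := H _ e0.
  apply/nbhs_ballP; exists d => //= h; rewrite /ball/= sub0r normrN => hd h0.
  have := Hd (h + x); rewrite addrK => /(_ hd); rewrite scaler1 => He.
  have -> : l - h^-1 *: (f (h + x) - f x) =
            - ((f (h + x) - f x - l * h) / h) by rewrite /GRing.scale/=; field.
  by rewrite normrN normrM normfV ler_pdivrMr ?normr_gt0.
by split; [apply/cvg_ex; exists l|exact/cvg_lim].
Qed.

Lemma is_derive_0_seg f a b : a <= b ->
  (forall x, x \in `[a, b] -> is_derive x 1 f 0) -> f a = f b.
Proof.
move=> ab f0.
have cf : {within `[a, b], continuous f}.
  by apply: derivable_within_continuous => x /f0[].
have df x : x \in `]a, b[ -> is_derive x 1 f ((fun=> 0) x).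
  by move=> xab; apply: f0; apply: subset_itv_oo_cc.
have [c _] := MVT_segment ab df cf.
by rewrite mul0r => /eqP; rewrite subr_eq0 => /eqP.
Qed.

Lemma continuous_seg_integrable f a b : continuous f ->
  mu.-integrable `[a, b] (EFin \o f).
Proof.
move=> cf; apply: continuous_compact_integrable; first exact: segment_compact.
exact: continuous_subspaceT.
Qed.

Lemma integral_FTC2 f g a b : a <= b -> continuous g ->
  (forall x, x \in `[a, b] -> is_derive x 1 f (g x)) ->
  \int[mu]_(x in `[a, b]) g x = f b - f a.
Proof.
rewrite le_eqVlt => /predU1P[->|ab] cg fg.
  by rewrite subrr set_itv1 Rintegral_set1.
have cf x : x \in `[a, b] -> {for x, continuous f}.
  by move=> /fg[d _]; exact/differentiable_continuous/derivable1_diffP.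
rewrite /Rintegral (@continuous_FTC2 _ _ f)//.
- exact: continuous_subspaceT.
- split.
  + by move=> x xab; have [] := fg x (subset_itv_oo_cc xab).
  + by apply: cvg_at_right_filter; apply: cf; rewrite in_itv/= lexx ltW.
  + by apply: cvg_at_left_filter; apply: cf; rewrite in_itv/= lexx ltW.
- move=> x xab; rewrite derive1E.
  by have [_] := fg x (subset_itv_oo_cc xab).
Qed.

(** The base point [a] is free because the derivative is obtained only strictly to its right: taking
    it below the interval of interest gives two-sided derivatives at the left end too. *)
Lemma continuous_primitive f a : continuous f ->
  exists F : R -> R, forall x, a < x -> is_derive x 1 F (f x).
Proof.
move=> cf; exists (fun x => \int[mu]_(t in `[a, x]) f t) => x ax.
have xx1 : x < x + 1 by rewrite ltrDl.
have fi := continuous_seg_integrable f a (x + 1) cf.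
have [d e] := continuous_FTC1_closed xx1 fi ax (cf x).
by split; [exact: d|rewrite -derive1E; exact: e].
Qed.

Lemma integral_seg_cat f a b c : continuous f -> a <= b -> b <= c ->
  \int[mu]_(x in `[a, c]) f x =
  \int[mu]_(x in `[a, b]) f x + \int[mu]_(x in `[b, c]) f x.
Proof.
move=> cf ab bc; have [F dF] := continuous_primitive f (a - 1) cf.
have dFi u v x : a <= u -> x \in `[u, v] -> is_derive x 1 F (f x).
  by rewrite in_itv/= => au /andP[ux _]; apply: dF; lra.
rewrite (integral_FTC2 F f a c (le_trans ab bc) cf (fun x => dFi a c x (lexx a))).
rewrite (integral_FTC2 F f a b ab cf (fun x => dFi a b x (lexx a))).
by rewrite (integral_FTC2 F f b c bc cf (fun x => dFi b c x ab)); lra.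
Qed.
End Calculus.

(** * The function phi -> cot psi_X(phi) and its uniform bounds *)

Section Slope.
Context {R : realType}.
Local Notation pt := (R * R)%type.
Implicit Types (X Y P Q : pt) (K : set pt) (phi : R).

(** [height] and [dheight] are the coordinates of X in the orthonormal frame R(phi), e(phi). *)
Definition height X phi : R := X.1 * cos phi + X.2 * sin phi.
Definition dheight X phi : R := X.2 * cos phi - X.1 * sin phi.
Definition slope X phi : R := dheight X phi / (1 - height X phi).
(** Up to sign and a term depending on X alone, the Busemann function of the ideal point R(phi);
    that term disappears on differentiating in phi. *)
Definition busemann X phi : R := - ln (1 - height X phi).

Lemma is_derive_height X phi : is_derive phi 1 (height X) (dheight X phi).
Proof.
rewrite /height; apply: is_derive_eq.
by rewrite /dheight /GRing.scale/=; ring.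
Qed.

Lemma is_derive_dheight X phi : is_derive phi 1 (dheight X) (- height X phi).
Proof.
rewrite /dheight; apply: is_derive_eq.
by rewrite /height /GRing.scale/=; ring.
Qed.

Lemma height2_dheight2 X phi :
  height X phi ^+ 2 + dheight X phi ^+ 2 = dot X X.
Proof.
rewrite -[RHS]mulr1 -(cos2Dsin2 phi) /height /dheight /dot; ring.
Qed.

Lemma height_lt1 X phi : diskD X -> height X phi < 1.
Proof. by rewrite /diskD/= -(height2_dheight2 X phi); nra. Qed.

Lemma height_periodic X phi : height X (phi + 2 * pi) = height X phi.
Proof. by rewrite /height mulr_natl cosD2pi sinD2pi. Qed.

Lemma dheight_periodic X phi : dheight X (phi + 2 * pi) = dheight X phi.
Proof. by rewrite /dheight mulr_natl cosD2pi sinD2pi. Qed.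

Lemma slope_periodic X phi : slope X (phi + 2 * pi) = slope X phi.
Proof. by rewrite /slope height_periodic dheight_periodic. Qed.

Lemma busemann_periodic X phi : busemann X (phi + 2 * pi) = busemann X phi.
Proof. by rewrite /busemann height_periodic. Qed.

Lemma is_derive_busemann X phi : diskD X ->
  is_derive phi 1 (busemann X) (slope X phi).
Proof.
move=> DX; have v0 : 0 < 1 - height X phi by rewrite subr_gt0 height_lt1.
have dh := is_derive_height X phi.
have dv : is_derive phi 1 (fun t => 1 - height X t) (- dheight X phi).
  by apply: is_derive_eq; rewrite add0r mul1r.
have dl := @is_derive1_comp R (@ln R) (fun t => 1 - height X t) phi _ _
  (is_derive1_ln v0) dv.
rewrite /busemann; apply: is_derive_eq.
by rewrite /slope mulrN opprK mulrC.
Qed.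

Lemma is_derive_slope X phi : diskD X ->
  is_derive phi 1 (slope X) (slope X phi ^+ 2 - height X phi / (1 - height X phi)).
Proof.
move=> DX; have v0 : 1 - height X phi != 0.
  by rewrite gt_eqF// subr_gt0 height_lt1.
have dh := is_derive_height X phi.
have dd := is_derive_dheight X phi.
have dv : is_derive phi 1 (fun t => 1 - height X t) (- dheight X phi).
  by apply: is_derive_eq; rewrite add0r mul1r.
have di := @is_deriveV R (fun t => 1 - height X t) phi _ 1 v0 dv.
rewrite /slope; apply: is_derive_eq.
by rewrite /GRing.scale/=; field.
Qed.

Lemma continuous_slope X : diskD X -> continuous (slope X).
Proof.
move=> DX; apply: (is_derive_continuous _ (fun phi =>
  slope X phi ^+ 2 - height X phi / (1 - height X phi))) => x.
exact: is_derive_slope.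
Qed.

(** Keeps the denominators of the slopes away from 0, uniformly in the point and in phi; all the
    Lipschitz constants below depend on this [k] only. *)
Lemma height_bound K : K !=set0 -> compact K -> K `<=` @diskD R ->
  exists2 k, 0 < k & forall X phi, K X -> k <= 1 - height X phi.
Proof.
move=> K0 cK KD.
have cdot : continuous (fun X : pt => dot X X).
  move=> X; rewrite /dot; apply: cvgD; apply: cvgM; (exact: cvg_fst || exact: cvg_snd).
have [Z] := compact_EVT_max K0 cK (continuous_subspaceT cdot).
(* From 2h <= 1 + h^2 <= 1 + |X|^2, where h is the height of X, follows 1 - h >= (1 - |X|^2)/2, and
   Z has the largest norm in K. *)
rewrite inE => KZ Zmax; exists ((1 - dot Z Z) / 2).
  by have := KD Z KZ; rewrite /diskD/=; lra.
move=> X phi KX; have := Zmax X; rewrite inE => /(_ KX).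
rewrite -(height2_dheight2 X phi).
have := sqr_ge0 (1 - height X phi); have := sqr_ge0 (dheight X phi).
by rewrite sqrrB; lra.
Qed.

Lemma dheight_norm_le1 X phi : diskD X -> `|dheight X phi| <= 1.
Proof.
rewrite /diskD/= -(height2_dheight2 X phi) => H.
by rewrite ler_norml; apply/andP; split; nra.
Qed.

Lemma height_norm_le1 X phi : diskD X -> `|height X phi| <= 1.
Proof.
rewrite /diskD/= -(height2_dheight2 X phi) => H.
by rewrite ler_norml; apply/andP; split; nra.
Qed.

Lemma slope_lipschitz_angle X (k : R) : diskD X -> 0 < k ->
  (forall phi, k <= 1 - height X phi) ->
  forall x y, `|slope X x - slope X y| <= (k ^- 2 + k^-1) * `|x - y|.
Proof.
move=> DX k0 kX; apply: (bounded_derive_lipschitz _ (fun phi =>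
    slope X phi ^+ 2 - height X phi / (1 - height X phi))) => x.
  exact: is_derive_slope.
have v0 := lt_le_trans k0 (kX x).
have kv : (1 - height X x)^-1 <= k^-1 by rewrite lef_pV2.
have iv0 : 0 <= (1 - height X x)^-1 by rewrite invr_ge0 ltW.
rewrite (le_trans (ler_normB _ _))// lerD//.
  rewrite normrX normrM (ger0_norm iv0) -exprVn lerXn2r ?nnegrE ?mulr_ge0//.
    by rewrite invr_ge0 ltW.
  by rewrite -[leRHS]mul1r ler_pM// dheight_norm_le1.
by rewrite normrM (ger0_norm iv0) -[leRHS]mul1r ler_pM// height_norm_le1.
Qed.

Lemma slope_lipschitz_point X Y (k : R) phi : diskD X -> diskD Y -> 0 < k ->
  k <= 1 - height X phi -> k <= 1 - height Y phi ->
  `|slope X phi - slope Y phi| <=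
    (k^-1 + k^-2) * (`|X.1 - Y.1| + `|X.2 - Y.2|).
Proof.
move=> DX DY k0 kX kY.
have vX := lt_le_trans k0 kX; have vY := lt_le_trans k0 kY.
set S := (X in _ * X).
have du : `|dheight X phi - dheight Y phi| <= S.
  have -> : dheight X phi - dheight Y phi =
      (X.2 - Y.2) * cos phi - (X.1 - Y.1) * sin phi by rewrite /dheight; ring.
  rewrite (le_trans (ler_normB _ _))// !normrM addrC lerD//.
    by rewrite -[leRHS]mulr1 ler_wpM2l// sin_max.
  by rewrite -[leRHS]mulr1 ler_wpM2l// cos_max.
have dv : `|height X phi - height Y phi| <= S.
  have -> : height X phi - height Y phi =
      (X.1 - Y.1) * cos phi + (X.2 - Y.2) * sin phi by rewrite /height; ring.
  rewrite (le_trans (ler_normD _ _))// !normrM lerD//.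
    by rewrite -[leRHS]mulr1 ler_wpM2l// cos_max.
  by rewrite -[leRHS]mulr1 ler_wpM2l// sin_max.
have -> : slope X phi - slope Y phi =
    (dheight X phi - dheight Y phi) / (1 - height X phi) +
    (height X phi - height Y phi) *
      (dheight Y phi / (1 - height X phi) / (1 - height Y phi)).
  by rewrite /slope; field; rewrite !gt_eqF.
have kv : (1 - height X phi)^-1 <= k^-1 by rewrite lef_pV2.
have kw : (1 - height Y phi)^-1 <= k^-1 by rewrite lef_pV2.
have iv0 : 0 <= (1 - height X phi)^-1 by rewrite invr_ge0 ltW.
have iw0 : 0 <= (1 - height Y phi)^-1 by rewrite invr_ge0 ltW.
rewrite (le_trans (ler_normD _ _))// [leRHS]mulrDl lerD//.
  by rewrite normrM (ger0_norm iv0) mulrC ler_pM.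
rewrite normrM mulrC ler_pM// !normrM (ger0_norm iv0) (ger0_norm iw0).
rewrite -exprVn expr2 ler_pM ?mulr_ge0// -[leRHS]mul1r ler_pM//.
exact: dheight_norm_le1.
Qed.

End Slope.

(** * The Crofton formula for the Hilbert distance *)

Section Crofton.
Context {R : realType}.
Local Notation pt := (R * R)%type.
Implicit Types (A B P Q : pt) (phi : R).

Lemma Rpt_surj A : dot A A = 1 -> exists2 a, 0 <= a < 2 * pi & Rpt a = A.
Proof.
case: A => x y; rewrite /dot/= => xy1.
have x1 : -1 <= x <= 1 by apply/andP; split; nra.
have sx : sin (acos x) = `|y|.
  by rewrite sin_acos// -(sqrtr_sqr y); congr Num.sqrt; rewrite !expr2; lra.
have a0 := acos_ge0 x1; have api := acos_lepi x1; have p0 := pi_gt0 R.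
have ca : cos (acos x) = x by rewrite acosK.
have [y0|y0] := leP 0 y.
  exists (acos x); first by apply/andP; split; lra.
  by rewrite /Rpt ca sx ger0_norm.
exists (2 * pi - acos x).
  rewrite subr_ge0 ltrBlDr ltrDl lt_neqAle a0 andbT; apply/andP; split; first lra.
  apply/eqP => a00; move: sx; rewrite -a00 sin0 => /esym/eqP.
  by rewrite normr_eq0 lt_eqF.
rewrite /Rpt mulr_natl cosB sinB cos2pi sin2pi ca sx (ltr0_norm y0).
by congr pair; ring.
Qed.

Definition chord_pt A B (s : R) : pt := (A.1 + s * (B.1 - A.1), A.2 + s * (B.2 - A.2)).

Lemma chord_ptC A B s : chord_pt A B s = chord_pt B A (1 - s).
Proof. by rewrite /chord_pt; congr pair; ring. Qed.

Lemma hdist_chord P Q : diskD P -> diskD Q -> P != Q ->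
  exists A B p q, [/\ dot A A = 1, dot B B = 1, 0 < p < q /\ q < 1,
    P = chord_pt A B p /\ Q = chord_pt A B q &
    2 * hdist P Q = ln (q / p * ((1 - p) / (1 - q)))].
Proof.
rewrite /diskD/= => DP DQ PQ.
have a0 : 0 < qa P Q.
  have -> : qa P Q = (Q.1 - P.1) ^+ 2 + (Q.2 - P.2) ^+ 2 by rewrite /qa /dot /psub/=; ring.
  rewrite lt0r addr_ge0 ?sqr_ge0// andbT paddr_eq0 ?sqr_ge0// !sqrf_eq0 !subr_eq0.
  by apply: contra PQ; rewrite eq_sym (eq_sym Q.2) -xpair_eqE -!surjective_pairing.
have c0 : qc P Q < 0 by rewrite /qc subr_lt0.
have f1 : 0 > qa P Q + qb P Q + qc P Q.
  suff -> : qa P Q + qb P Q + qc P Q = dot Q Q - 1 by rewrite subr_lt0.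
  by rewrite /qa /qb /qc /dot /psub/=; ring.
set a := qa P Q in a0 f1 *; set b := qb P Q in f1 *; set c := qc P Q in c0 f1 *.
have D0 : 0 < qdisc P Q by rewrite /qdisc -/a -/b -/c; nra.
set d := Num.sqrt (qdisc P Q).
have d2 : d ^+ 2 = b ^+ 2 - 4 * a * c by rewrite sqr_sqrtr ?ltW.
have d0 : 0 < d by rewrite sqrtr_gt0.
pose tA := (- b - d) / (2 * a); pose tB := (- b + d) / (2 * a).
have eA : a * tA ^+ 2 + b * tA + c = 0.
  have : a * 4 * (a * tA ^+ 2 + b * tA + c) = 0.
    have -> : a * 4 * (a * tA ^+ 2 + b * tA + c) = d ^+ 2 - (b ^+ 2 - 4 * a * c).
      by rewrite /tA; field; rewrite gt_eqF.
    by rewrite d2 subrr.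
  by move/eqP; rewrite mulf_eq0 gt_eqF/= ?mulr_gt0// => /eqP.
have eB : a * tB ^+ 2 + b * tB + c = 0.
  have : a * 4 * (a * tB ^+ 2 + b * tB + c) = 0.
    have -> : a * 4 * (a * tB ^+ 2 + b * tB + c) = d ^+ 2 - (b ^+ 2 - 4 * a * c).
      by rewrite /tB; field; rewrite gt_eqF.
    by rewrite d2 subrr.
  by move/eqP; rewrite mulf_eq0 gt_eqF/= ?mulr_gt0// => /eqP.
(* d^2 - b^2 = -4ac and d^2 - (2a + b)^2 = -4a(a + b + c) are positive because P and Q lie in the
   disk; the two bounds place the roots at [tA] < 0 and [tB] > 1. *)
have bd : `|b| < d by rewrite -ltr_sqr ?nnegrE// ?ltW// real_normK ?num_real// d2; nra.
have bd1 : `|2 * a + b| < d.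
  by rewrite -ltr_sqr ?nnegrE// ?ltW// real_normK ?num_real// d2; nra.
move: bd bd1; rewrite !ltr_norml => /andP[bd3 bd4] /andP[bd1 bd2].
have tA0 : tA < 0 by rewrite /tA pmulr_llt0 ?invr_gt0; lra.
have tB1 : 1 < tB by rewrite /tB ltr_pdivlMr; lra.
have tAB : 0 < tB - tA by lra.
have tAB0 : tB - tA != 0 by rewrite gt_eqF.
(* The affine change of parameter that sends [tA] to 0 and [tB] to 1 sends P (t = 0) and Q (t = 1)
   to these two values. *)
exists (ideal_A P Q), (ideal_B P Q), (- tA / (tB - tA)), ((1 - tA) / (tB - tA)).
have nA t : dot (padd P (pscale t (psub Q P))) (padd P (pscale t (psub Q P))) =
            a * t ^+ 2 + b * t + c + 1.
  by rewrite /a /b /c /qa /qb /qc /dot /psub /pscale /padd/=; ring.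
split.
- by rewrite /ideal_A nA -/a -/b -/d -/tA eA add0r.
- by rewrite /ideal_B nA -/a -/b -/d -/tB eB add0r.
- split; last by rewrite ltr_pdivrMr; lra.
  by rewrite divr_gt0 ?ltr_pM2r ?invr_gt0//; lra.
- rewrite /ideal_A /ideal_B -/a -/b -/d -/tA -/tB /chord_pt /padd /pscale /psub.
  by split; apply/eqP; rewrite -pair_eqE /pair_eq/=; apply/andP; split; apply/eqP; field.
- have nr t : Defs.edist (padd P (pscale t (psub Q P))) Q = `|1 - t| * Num.sqrt a.
    rewrite -sqrtr_sqr -sqrtrM ?sqr_ge0// /Defs.edist /enorm; congr Num.sqrt.
    by rewrite /a /qa /dot /psub /pscale /padd/=; ring.
  have nl t : Defs.edist (padd P (pscale t (psub Q P))) P = `|t| * Num.sqrt a.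
    rewrite -sqrtr_sqr -sqrtrM ?sqr_ge0// /Defs.edist /enorm; congr Num.sqrt.
    by rewrite /a /qa /dot /psub /pscale /padd/=; ring.
  have sa0 : Num.sqrt a != 0 by rewrite gt_eqF ?sqrtr_gt0.
  have half (x : R) : 2 * (1 / 2 * x) = x by field.
  rewrite /hdist (negPf PQ) half /ideal_A /ideal_B -/a -/b -/d -/tA -/tB !nr !nl; congr ln.
  have -> : `|1 - tA| = 1 - tA by rewrite ger0_norm; lra.
  have -> : `|tA| = - tA by rewrite ler0_norm; lra.
  have -> : `|1 - tB| = tB - 1 by rewrite ler0_norm; lra.
  have -> : `|tB| = tB by rewrite ger0_norm; lra.
  have tB0 : tB - tA - (1 - tA) != 0 by rewrite gt_eqF//; lra.
  by field; rewrite sa0 tAB0 tB0 lt_eqF.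
Qed.

Lemma sin_sum_halves (x y : R) :
  sin x + sin y - sin (x + y) = 4 * (sin (x / 2) * sin (y / 2) * sin ((x + y) / 2)).
Proof.
have E z : z = z / 2 + z / 2 :> R by lra.
have -> : (x + y) / 2 = x / 2 + y / 2 by lra.
rewrite [in LHS](E x) [in LHS](E y) !(sinD, cosD).
have := sin2cos2 (x / 2); have := sin2cos2 (y / 2).
move: (cos (x / 2)) (sin (x / 2)) (cos (y / 2)) (sin (y / 2)) => a b c d.
by move=> e1 e2; ring: e1 e2.
Qed.

Lemma height_Rpt a phi : height (Rpt a) phi = cos (a - phi).
Proof. by rewrite /height /= cosB. Qed.

Lemma dheight_Rpt a phi : dheight (Rpt a) phi = sin (a - phi).
Proof. by rewrite /dheight /= sinB; ring. Qed.

Lemma height_chord_pt A B s phi :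
  height (chord_pt A B s) phi = height A phi + s * (height B phi - height A phi).
Proof. by rewrite /height /=; ring. Qed.

Lemma dheight_chord_pt A B s phi :
  dheight (chord_pt A B s) phi = dheight A phi + s * (dheight B phi - dheight A phi).
Proof. by rewrite /dheight /=; ring. Qed.

(** The numerator is the determinant of the vectors (dheight, 1 - height) of P and Q. They are
    affine in the chord parameter, so it is q - p times the determinant for the two ideal endpoints,
    which [sin_sum_halves] factors. The sign in phi can then be read off. *)
Lemma slopeB_chord a b (p q : R) phi (P := chord_pt (Rpt a) (Rpt b) p)
    (Q := chord_pt (Rpt a) (Rpt b) q) :
  height P phi < 1 -> height Q phi < 1 ->
  slope P phi - slope Q phi =
  4 * (q - p) * (sin ((a - phi) / 2) * sin ((b - a) / 2) * sin ((b - phi) / 2))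
  / ((1 - height P phi) * (1 - height Q phi)).
Proof.
move=> hP hQ.
have := sin_sum_halves (a - phi) (b - a).
have -> : a - phi + (b - a) = b - phi by ring.
move=> E; have -> : forall z : R, 4 * (q - p) * z = (q - p) * (4 * z) by move=> z; ring.
rewrite -E /slope.
have -> : b - a = (b - phi) - (a - phi) by ring.
rewrite (sinB (b - phi)) -!height_Rpt -!dheight_Rpt.
have vP : 1 - height P phi != 0 by rewrite gt_eqF// subr_gt0.
have vQ : 1 - height Q phi != 0 by rewrite gt_eqF// subr_gt0.
apply: (mulIf (mulf_neq0 vP vQ)); rewrite divfK ?mulf_neq0//.
have -> : (dheight P phi / (1 - height P phi) - dheight Q phi / (1 - height Q phi)) *
  ((1 - height P phi) * (1 - height Q phi)) =
  dheight P phi * (1 - height Q phi) - dheight Q phi * (1 - height P phi).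
  by field; rewrite vP vQ.
by rewrite /P /Q !height_chord_pt !dheight_chord_pt; ring.
Qed.

(** The difference of slopes is >= 0, <= 0, >= 0 on [0, a], [a, b], [b, 2 pi]. With its primitive
    [H], a difference of Busemann functions, the total is 2 (H a - H b) by periodicity. *)
Lemma integral_slopeB_chord a b (p q : R) (P := chord_pt (Rpt a) (Rpt b) p)
    (Q := chord_pt (Rpt a) (Rpt b) q) :
  0 <= a -> a < b -> b < 2 * pi -> 0 < p -> p < q -> q < 1 ->
  diskD P -> diskD Q ->
  \int[lebesgue_measure]_(phi in `[0, 2 * pi]) `|slope P phi - slope Q phi| =
  2 * ln (q / p * ((1 - p) / (1 - q))).
Proof.
move=> a0 ab b2 p0 pq q1 DP DQ.
have cP := continuous_slope P DP; have cQ := continuous_slope Q DQ.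
pose H phi := busemann P phi - busemann Q phi.
have dH phi : is_derive phi 1 H (slope P phi - slope Q phi).
  have dP := is_derive_busemann P phi DP; have dQ := is_derive_busemann Q phi DQ.
  exact: is_deriveB.
have cd : continuous (fun phi => slope P phi - slope Q phi).
  by move=> x; apply: cvgB; [exact: cP|exact: cQ].
have cn : continuous (fun phi => `|slope P phi - slope Q phi|).
  by move=> x; apply: cvg_norm; exact: cd.
(* p < q and 0 < b - a < 2 pi make every other factor nonnegative, so the two half-angle sines alone
   decide the sign. *)
have [c [c0 cE]] : exists c : R -> R, (forall phi, 0 <= c phi) /\ forall phi,
    slope P phi - slope Q phi = c phi * (sin ((a - phi) / 2) * sin ((b - phi) / 2)).
  exists (fun phi => 4 * (q - p) * sin ((b - a) / 2) /
    ((1 - height P phi) * (1 - height Q phi))); split => phi; last first.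
    by rewrite slopeB_chord ?height_lt1//; ring.
  rewrite divr_ge0//; last by rewrite mulr_ge0// subr_ge0 ltW// height_lt1.
  rewrite mulr_ge0 ?mulr_ge0 ?sin_ge0_pi//; lra.
have sN x : - (2 * pi) <= x <= 0 -> sin (x / 2) <= 0.
  move=> xpi; rewrite -oppr_ge0 -sinN sin_ge0_pi//; lra.
have sP x : 0 <= x <= 2 * pi -> 0 <= sin (x / 2).
  by move=> xpi; rewrite sin_ge0_pi//; lra.
have E1 : \int[lebesgue_measure]_(phi in `[0, a]) `|slope P phi - slope Q phi| = H a - H 0.
  rewrite -(integral_FTC2 H _ 0 a a0 cd (fun x _ => dH x)).
  apply: eq_Rintegral => x; rewrite inE/= in_itv/= => /andP[x0 xa].
  rewrite ger0_norm// cE !mulr_ge0// sP//; lra.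
have E2 : \int[lebesgue_measure]_(phi in `[a, b]) `|slope P phi - slope Q phi| = H a - H b.
  have cN : continuous (fun phi => - (slope P phi - slope Q phi)).
    by move=> x; apply: cvgN; exact: cd.
  have dN x : x \in `[a, b] -> is_derive x 1 (fun y => - H y) (- (slope P x - slope Q x)).
    by move=> _; apply: is_deriveN; exact: dH.
  have -> : H a - H b = - H b - - H a by ring.
  rewrite -(integral_FTC2 (fun y => - H y) _ a b (ltW ab) cN dN).
  apply: eq_Rintegral => x; rewrite inE/= in_itv/= => /andP[x0 xa].
  rewrite ler0_norm// cE mulr_ge0_le0// mulr_le0_ge0//; [apply: sN|apply: sP]; lra.
have E3 : \int[lebesgue_measure]_(phi in `[b, 2 * pi]) `|slope P phi - slope Q phi| =
    H (2 * pi) - H b.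
  rewrite -(integral_FTC2 H _ b (2 * pi) (ltW b2) cd (fun x _ => dH x)).
  apply: eq_Rintegral => x; rewrite inE/= in_itv/= => /andP[x0 xa].
  rewrite ger0_norm// cE mulr_ge0// mulr_le0//; apply: sN; lra.
rewrite (integral_seg_cat _ 0 a _ cn) ?E1//; last lra.
rewrite (integral_seg_cat _ a b _ cn) ?E2 ?E3//; [|lra|lra].
have -> : H (2 * pi) = H 0.
  by rewrite /H -{1 2}[2 * pi]add0r !busemann_periodic.
have pb : sin ((b - a) / 2) != 0.
  by rewrite gt_eqF// sin_gt0_pi//; lra.
have k0 : 0 < 1 - cos (b - a).
  have -> : b - a = (b - a) / 2 *+ 2 by rewrite -mulr_natr; field.
  rewrite cos_mulr2n cos2sin2 mulr2n.
  have : 0 < sin ((b - a) / 2) ^+ 2 by rewrite exprn_even_gt0.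
  lra.
have cba : cos (a - b) = cos (b - a) by rewrite -cosN opprB.
(* At phi = a the quantity 1 - height vanishes on Rpt a, hence at chord parameter p it equals p (1 -
   cos (b - a)); at phi = b the weight is 1 - p. The common factor cancels in [H], leaving the cross
   ratio. *)
have HE x (u v : R) : 0 < u -> 0 < v -> 1 - height P x = u * (1 - cos (b - a)) ->
    1 - height Q x = v * (1 - cos (b - a)) -> H x = ln v - ln u.
  move=> u0 v0 hu hv; rewrite /H /busemann hu hv !lnM ?posrE//; ring.
rewrite (HE a p q)//; [|lra|..]; rewrite ?height_chord_pt ?height_Rpt ?subrr ?cos0; try ring.
rewrite (HE b (1 - p) (1 - q))//; [|lra|lra|..]; rewrite ?height_chord_pt ?height_Rpt ?subrr ?cos0 ?cba; try ring.
rewrite lnM ?posrE ?divr_gt0 ?ln_div ?posrE//; lra.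
Qed.

Theorem crofton_hdist P Q : diskD P -> diskD Q ->
  \int[lebesgue_measure]_(phi in `[0, 2 * pi]) `|slope P phi - slope Q phi| =
  4 * hdist P Q.
Proof.
move=> DP DQ; have [<-|PQ] := eqVneq P Q.
  under eq_Rintegral do rewrite subrr normr0.
  by rewrite Rintegral_cst// mul0r /hdist eqxx mulr0.
have [A [B [p [q [A1 B1 [/andP[p0 pq] q1] [PE QE] hE]]]]] := hdist_chord P Q DP DQ PQ.
have -> : 4 * hdist P Q = 2 * (2 * hdist P Q) by ring.
rewrite hE; have [a /andP[a0 a2] aE] := Rpt_surj A A1.
have [b /andP[b0 b2] bE] := Rpt_surj B B1.
move: PE QE; rewrite -aE -bE => PE QE.
have [ab|ba|ab] := ltgtP a b.
- rewrite PE QE; apply: integral_slopeB_chord => //; first by rewrite -PE.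
  by rewrite -QE.
(* For b < a the chord is run backwards: the parameters become 1 - q < 1 - p, and the cross ratio is
   unchanged. *)
- under eq_Rintegral do rewrite distrC.
  rewrite PE QE !(chord_ptC (Rpt a)) integral_slopeB_chord//; try lra.
  + by congr (2 * ln _); rewrite mulrC; congr (_ * _); congr (_ / _); ring.
  + by rewrite -chord_ptC -QE.
  + by rewrite -chord_ptC -PE.
- case/eqP: PQ; rewrite PE QE ab /chord_pt; congr pair; ring.
Qed.

End Crofton.

(** * The integral relation between the two extremal slopes, for Lipschitz data *)

Section SupportIntegral.
Context {R : realType}.
Implicit Types (f g p M m : R -> R) (x y : R).
Notation mu := (@lebesgue_measure R).

(** A chain rule without a derivative of the inner function: the linear term stays in p y - p x, and
    the Lipschitz bound turns the error into one of order y - x. *)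
Lemma is_derive_expand_comp f p (C l x : R) :
  (forall y, `|p y - p x| <= C * `|y - x|) -> is_derive (p x) 1 f l ->
  forall e, 0 < e -> exists2 d, 0 < d & forall y, `|y - x| < d ->
    `|f (p y) - f (p x) - l * (p y - p x)| <= e * `|y - x|.
Proof.
move=> pC dl e e0.
have C0 : 0 < `|C| + 1 by rewrite ltr_pwDr.
have pC' y : `|p y - p x| <= (`|C| + 1) * `|y - x|.
  rewrite (le_trans (pC y))// ler_wpM2r// (le_trans (ler_norm _))// lerDl//.
have [d d0 Hd] := is_derive_expand f (p x) l dl (e / (`|C| + 1)) (divr_gt0 e0 C0).
exists (d / (`|C| + 1)); first exact: divr_gt0.
move=> y; rewrite ltr_pdivlMr// mulrC => yx.
rewrite (le_trans (Hd _ (le_lt_trans (pC' y) yx)))//.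
by rewrite mulrAC ler_pdivrMr// -mulrA ler_wpM2l// 1?mulrC// ltW.
Qed.

Lemma lipschitz_atan x y : `|atan x - atan y| <= `|x - y| :> R.
Proof.
have H := bounded_derive_lipschitz (@atan R) (fun t => (1 + t ^+ 2)^-1) 1
  (fun t => is_derive1_atan t).
rewrite -[leRHS]mul1r; apply: H => t.
have t0 : 0 < 1 + t ^+ 2 by rewrite ltr_pwDl// sqr_ge0.
by rewrite ger0_norm; [rewrite invf_le1// lerDl sqr_ge0|rewrite invr_ge0 ltW].
Qed.

(** The coefficient 2 M0 is frozen at the base point, which makes the function stationary there: a
    Lipschitz M inserted for v contributes nothing to first order, differentiable or not. *)
Lemma is_derive_touch (M0 : R) :
  is_derive M0 1 (fun v => 2 * M0 * atan v - ln (1 + v ^+ 2)) 0.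
Proof.
have t0 : 0 < 1 + M0 ^+ 2 by rewrite ltr_pwDl// sqr_ge0.
have dv : is_derive M0 1 (fun t => 1 + t ^+ 2) (2 * M0).
  by apply: is_derive_eq; rewrite add0r /GRing.scale/=; ring.
have dl := @is_derive1_comp R (@ln R) (fun t => 1 + t ^+ 2) M0 _ _
  (is_derive1_ln t0) dv.
have da := is_derive1_atan M0.
apply: is_derive_eq; rewrite /GRing.scale/=; field.
by rewrite gt_eqF.
Qed.

(* The line through Rpt x with slope M x leaves the disk at
   Rpt (x + pi - 2 atan (M x)), where it is the other extremal line. *)
Lemma integral_extremal_slopes M m (C : R) :
  (forall x y, `|M x - M y| <= C * `|x - y|) -> continuous m ->
  (forall x, M (x + 2 * pi) = M x) -> (forall x, m (x + 2 * pi) = m x) ->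
  (forall x, m (x + pi - 2 * atan (M x)) = - M x) ->
  \int[mu]_(x in `[0, 2 * pi]) M x + \int[mu]_(x in `[0, 2 * pi]) m x = 0.
Proof.
move=> MC cm Mp mp mM; have p0 := pi_gt0 R.
have cM := lipschitz_continuous M C MC.
have [I dI] := continuous_primitive M (-1) cM.
have [J dJ] := continuous_primitive m (-1) cm.
pose s x := x + pi - 2 * atan (M x).
have s0 x : 0 <= x -> 0 < s x.
  by move=> x0; rewrite /s; have := atan_ltpi2 (M x); lra.
(* For smooth M, (J o s)' = m(s) s' = -M (1 - 2M'/(1 + M^2)) = -M + (ln(1 + M^2))', so [W] would be
   constant; the expansions below prove this for Lipschitz M. *)
pose W x := I x + J (s x) - ln (1 + M x ^+ 2).
have sC x y : `|s y - s x| <= (1 + 2 * C) * `|y - x|.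
  have -> : s y - s x = (y - x) - 2 * (atan (M y) - atan (M x)).
    by rewrite /s; ring.
  rewrite (le_trans (ler_normB _ _))// [leRHS]mulrDl mul1r lerD// normrM ger0_norm//.
  by rewrite -mulrA ler_wpM2l// (le_trans (lipschitz_atan _ _)).
have dW x : x \in `[0, 2 * pi] -> is_derive x 1 W 0.
  rewrite in_itv/= => /andP[x0 _]; apply: expand_is_derive => e e0.
  have e3 : 0 < e / 3 by lra.
  have [d1 d10 H1] := is_derive_expand I x (M x) (dI x ltac:(lra)) _ e3.
  have Jsx : -1 < s x by have := s0 x x0; lra.
  have [d2 d20 H2] := is_derive_expand_comp J s _ _ x (sC x) (dJ _ Jsx) _ e3.
  have [d3 d30 H3] := is_derive_expand_comp _ M _ _ x (fun y => MC y x)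
    (is_derive_touch (M x)) _ e3.
  exists (Num.min d1 (Num.min d2 d3)); first by rewrite !lt_min d10 d20 d30.
  move=> y; rewrite !lt_min => /and3P[/H1 {}H1 /H2 {}H2 /H3 {}H3].
  rewrite mul0r subr0.
  (* By m (s x) = - M x the linear terms of I and J o s combine into 2 M x (atan (M y) - atan (M
     x)), which joins the logarithm in the third, stationary bracket. *)
  have -> : W y - W x = (I y - I x - M x * (y - x)) +
      (J (s y) - J (s x) - m (s x) * (s y - s x)) +
      (2 * M x * atan (M y) - ln (1 + M y ^+ 2) -
       (2 * M x * atan (M x) - ln (1 + M x ^+ 2)) - 0 * (M y - M x)).
    by rewrite mM /W /s; ring.
  have -> : e * `|y - x| = e / 3 * `|y - x| + e / 3 * `|y - x| + e / 3 * `|y - x|.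
    by field.
  by rewrite (le_trans (ler_normD _ _))// lerD// (le_trans (ler_normD _ _))// lerD.
have pp : 0 <= 2 * pi :> R by lra.
have W0 := is_derive_0_seg W 0 (2 * pi) pp dW.
have dI' x : x \in `[0, 2 * pi] -> is_derive x 1 I (M x).
  by rewrite in_itv/= => /andP[x0 _]; apply: dI; lra.
have dJ' x : x \in `[0, 2 * pi] -> is_derive x 1 J (m x).
  by rewrite in_itv/= => /andP[x0 _]; apply: dJ; lra.
rewrite (integral_FTC2 I M 0 (2 * pi) pp cM dI') (integral_FTC2 J m 0 (2 * pi) pp cm dJ').
(* [W] sees J over the period that starts at s 0; periodicity of m moves it to the one that starts
   at 0. *)
have JE : J (0 + 2 * pi) - J 0 = J (s 0 + 2 * pi) - J (s 0).
  apply: (is_derive_0_seg (fun x => J (x + 2 * pi) - J x)); first by rewrite ltW// s0.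
  move=> x; rewrite in_itv/= => /andP[x0 _].
  have d1 : is_derive x 1 (fun x => x + 2 * pi) (1 : R).
    by apply: is_derive_eq; rewrite addr0.
  have xp : -1 < x + 2 * pi by lra.
  have d2 := @is_derive1_comp R J (fun x => x + 2 * pi) x _ _ (dJ _ xp) d1.
  have xp' : -1 < x by lra.
  have d3 := dJ _ xp'.
  by apply: is_derive_eq; rewrite mp mulr1 subrr.
have sp : s (2 * pi) = s 0 + 2 * pi.
  by rewrite /s -[2 * pi]add0r Mp; ring.
move: W0; rewrite /W sp; have := Mp 0; rewrite add0r => ->.
by move: JE; rewrite add0r; lra.
Qed.
End SupportIntegral.

(** * Maximal and minimal slopes over a compact set *)

Section ExtremalSlopes.
Context {R : realType}.
Local Notation pt := (R * R)%type.
Implicit Types (X Y : pt) (K : set pt) (phi x y v : R).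
Notation mu := (@lebesgue_measure R).

Definition max_slope K phi : R := sup [set slope X phi | X in K].
Definition min_slope K phi : R := inf [set slope X phi | X in K].

Lemma continuous_slope_point phi X : diskD X -> {for X, continuous (slope^~ phi)}.
Proof.
move=> DX; rewrite /slope.
have v0 : 1 - height X phi != 0 by rewrite gt_eqF// subr_gt0 height_lt1.
apply: cvgM.
  by rewrite /dheight; apply: cvgB; apply: cvgM;
     (exact: cvg_fst || exact: cvg_snd || exact: cvg_cst).
apply: cvgV => //; apply: cvgB; first exact: cvg_cst.
by rewrite /height; apply: cvgD; apply: cvgM;
  (exact: cvg_fst || exact: cvg_snd || exact: cvg_cst).
Qed.

Section Compact.
Variable K : set pt.
Hypotheses (K0 : K !=set0) (cK : compact K) (KD : K `<=` @diskD R).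

Let within_slope phi : {within K, continuous (slope^~ phi)}.
Proof.
apply: continuous_in_subspaceT => X; rewrite inE => /KD.
exact: continuous_slope_point.
Qed.

Lemma max_slope_ex phi : exists2 X, K X &
  max_slope K phi = slope X phi /\ forall Y, K Y -> slope Y phi <= slope X phi.
Proof.
have [X] := compact_EVT_max K0 cK (within_slope phi); rewrite inE => KX Xmax.
have Xub Y : K Y -> slope Y phi <= slope X phi by move=> KY; apply: Xmax; rewrite inE.
exists X => //; split=> //; apply/le_anti/andP; split.
  by apply: ge_sup; [exists (slope X phi), X|move=> _ [Y KY <-]; exact: Xub].
by apply: ub_le_sup; [exists (slope X phi) => _ [Y KY <-]; exact: Xub|exists X].
Qed.

Lemma min_slope_ex phi : exists2 X, K X &
  min_slope K phi = slope X phi /\ forall Y, K Y -> slope X phi <= slope Y phi.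
Proof.
have [X] := compact_EVT_min K0 cK (within_slope phi); rewrite inE => KX Xmin.
have Xlb Y : K Y -> slope X phi <= slope Y phi by move=> KY; apply: Xmin; rewrite inE.
exists X => //; split=> //; apply/le_anti/andP; split.
  by apply: ge_inf; [exists (slope X phi) => _ [Y KY <-]; exact: Xlb|exists X].
by apply: lb_le_inf; [exists (slope X phi), X|move=> _ [Y KY <-]; exact: Xlb].
Qed.

Lemma slope_le_max phi X : K X -> slope X phi <= max_slope K phi.
Proof. by have [Y _ [-> H]] := max_slope_ex phi; exact: H. Qed.

Lemma min_le_slope phi X : K X -> min_slope K phi <= slope X phi.
Proof. by have [Y _ [-> H]] := min_slope_ex phi; exact: H. Qed.

(** A maximum of functions with a common Lipschitz constant inherits it: the larger value is
    compared at its own maximizing point. *)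
Lemma max_slope_lipschitz : exists C, forall x y,
  `|max_slope K x - max_slope K y| <= C * `|x - y|.
Proof.
have [k k0 kK] := height_bound K K0 cK KD.
exists (k ^- 2 + k^-1) => x y.
wlog H : x y / max_slope K y <= max_slope K x.
  move=> H; have [/H//|/ltW/H] := leP (max_slope K y) (max_slope K x).
  by rewrite distrC (distrC y).
rewrite ger0_norm ?subr_ge0//; have [X KX [-> _]] := max_slope_ex x.
apply: le_trans (slope_lipschitz_angle X k (KD _ KX) k0 (fun t => kK X t KX) x y).
by rewrite (le_trans _ (ler_norm _))// lerB// slope_le_max.
Qed.

Lemma min_slope_lipschitz : exists C, forall x y,
  `|min_slope K x - min_slope K y| <= C * `|x - y|.
Proof.
have [k k0 kK] := height_bound K K0 cK KD.
exists (k ^- 2 + k^-1) => x y.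
wlog H : x y / min_slope K y <= min_slope K x.
  move=> H; have [/H//|/ltW/H] := leP (min_slope K y) (min_slope K x).
  by rewrite distrC (distrC y).
rewrite ger0_norm ?subr_ge0//; have [X KX [-> _]] := min_slope_ex y.
apply: le_trans (slope_lipschitz_angle X k (KD _ KX) k0 (fun t => kK X t KX) x y).
by rewrite (le_trans _ (ler_norm _))// lerB// min_le_slope.
Qed.

End Compact.

Lemma max_slope_periodic K phi : max_slope K (phi + 2 * pi) = max_slope K phi.
Proof.
by congr sup; apply/seteqP; split => _ [X KX <-]; exists X => //;
  rewrite slope_periodic.
Qed.

Lemma min_slope_periodic K phi : min_slope K (phi + 2 * pi) = min_slope K phi.
Proof.
by congr inf; apply/seteqP; split => _ [X KX <-]; exists X => //;
  rewrite slope_periodic.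
Qed.

(* A chord seen with slope v from the endpoint Rpt x has slope - v seen from
   its other endpoint. *)
Lemma slope_other_end X x v : diskD X -> exists2 k, 0 < k &
  slope X (x + pi - 2 * atan v) + v = k * (v - slope X x).
Proof.
move=> DX; set t := atan v; set y := x + pi - 2 * t.
have c0 : 0 < cos t by apply: cos_gt0_pihalf; rewrite atan_gtNpi2 atan_ltpi2.
have sE : sin t = v * cos t by rewrite -[v in RHS]atanK -/t /tan divfK// gt_eqF.
have hx := height_lt1 X x DX; have hy := height_lt1 X y DX.
(* With z = x - t both sides equal sin t - dheight X z. The equation dheight X z = sin t defines the
   line of slope v through Rpt x, whose ideal ends are at the angles z + t = x and z + pi - t =
   y. *)
have id : sin t * (1 - height X x) - cos t * dheight X x =
          sin t * (1 - height X y) + cos t * dheight X y.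
  rewrite /y /height /dheight.
  have [z xE] : exists z, x = z + t by exists (x - t); ring.
  have -> : x + pi - 2 * t = z - t + pi by rewrite xE; ring.
  rewrite xE !(cosDpi, sinDpi) !(cosD, sinD) cosN sinN.
  move: (cos z) (sin z) => a b.
  have := sin2cos2 t; move: (sin t) (cos t) => c d e.
  by ring: e.
exists ((1 - height X x) / (1 - height X y)); first by rewrite divr_gt0 ?subr_gt0.
have vx : 1 - height X x != 0 by rewrite gt_eqF ?subr_gt0.
have vy : 1 - height X y != 0 by rewrite gt_eqF ?subr_gt0.
apply: (mulIf (mulf_neq0 vy (lt0r_neq0 c0))).
move: id; rewrite sE => id.
have -> : (slope X y + v) * ((1 - height X y) * cos t) =
   v * cos t * (1 - height X y) + cos t * dheight X y.
  by rewrite /slope; field.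
by rewrite -id /slope; field; rewrite vx vy.
Qed.

(** The factor in [slope_other_end] depends on X, but its positivity is enough: slope <= v at x
    gives slope >= -v at the other end, with equality for the maximizer. *)
Lemma min_slope_other_end K x : K !=set0 -> compact K -> K `<=` @diskD R ->
  min_slope K (x + pi - 2 * atan (max_slope K x)) = - max_slope K x.
Proof.
move=> K0 cK KD; set v := max_slope K x; set y := x + pi - 2 * atan v.
apply/eqP; rewrite eq_le; apply/andP; split.
  have [X KX [vE _]] := max_slope_ex K K0 cK KD x.
  have [k _] := slope_other_end X x v (KD _ KX).
  rewrite -vE subrr mulr0 => /eqP; rewrite addr_eq0 => /eqP <-.
  exact: min_le_slope.
have [X KX [-> _]] := min_slope_ex K K0 cK KD y.
have [k k0] := slope_other_end X x v (KD _ KX); rewrite -/y => E.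
have : 0 <= k * (v - slope X x) by rewrite mulr_ge0 ?subr_ge0 ?slope_le_max ?ltW.
by rewrite -E; lra.
Qed.

Lemma integral_max_min_slope K : K !=set0 -> compact K -> K `<=` @diskD R ->
  \int[mu]_(x in `[0, 2 * pi]) max_slope K x +
  \int[mu]_(x in `[0, 2 * pi]) min_slope K x = 0.
Proof.
move=> K0 cK KD; have [C HC] := max_slope_lipschitz K K0 cK KD.
have [C' HC'] := min_slope_lipschitz K K0 cK KD.
apply: (integral_extremal_slopes _ _ C) => //.
- exact: lipschitz_continuous HC'.
- exact: max_slope_periodic.
- exact: min_slope_periodic.
- by move=> x; exact: min_slope_other_end.
Qed.

End ExtremalSlopes.

(** * Slopes at interior points; slopes and angles *)

Section SupportDistance.
Context {R : realType}.
Local Notation pt := (R * R)%type.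
Implicit Types (X Y Z V : pt) (K : set pt) (phi : R).

Lemma interior_translate K Z V : K^° Z ->
  exists2 e, 0 < e & K (Z.1 + e * V.1, Z.2 + e * V.2).
Proof.
move=> KZ; pose p (e : R) : pt := (Z.1 + e * V.1, Z.2 + e * V.2).
have pc : p e @[e --> (0 : R)] --> Z.
  have H (a b : R) : a + e * b @[e --> (0 : R)] --> a.
    have {2}-> : a = a + 0 * b by rewrite mul0r addr0.
    by apply: cvgD; [exact: cvg_cst|apply: cvgM; [exact: cvg_id|exact: cvg_cst]].
  rewrite (surjective_pairing Z); exact: (cvg_pair (H Z.1 V.1) (H Z.2 V.2)).
have /nbhs_ballP[d d0 Hd] := pc _ KZ.
exists (d / 2); first by rewrite divr_gt0.
apply: (Hd (d / 2)); rewrite /ball/= sub0r normrN ger0_norm ?divr_ge0 ?(ltW d0)//.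
by rewrite ltr_pdivrMr// ltr_pMr//; lra.
Qed.

Lemma height_translate X V e phi :
  height (X.1 + e * V.1, X.2 + e * V.2) phi = height X phi + e * height V phi.
Proof. by rewrite /height/=; ring. Qed.

Lemma dheight_translate X V e phi :
  dheight (X.1 + e * V.1, X.2 + e * V.2) phi = dheight X phi + e * dheight V phi.
Proof. by rewrite /dheight/=; ring. Qed.

Lemma height_frame (a b phi : R) :
  height (a * cos phi - b * sin phi, a * sin phi + b * cos phi) phi = a.
Proof. by have e := sin2cos2 phi; rewrite /height/=; ring: e. Qed.

Lemma dheight_frame (a b phi : R) :
  dheight (a * cos phi - b * sin phi, a * sin phi + b * cos phi) phi = b.
Proof. by have e := sin2cos2 phi; rewrite /dheight/=; ring: e. Qed.

Lemma lt_slope X phi c : diskD X ->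
  (c < slope X phi) = (0 < dheight X phi - c * (1 - height X phi)).
Proof. by move=> DX; rewrite subr_gt0 /slope ltr_pdivlMr// subr_gt0 height_lt1. Qed.

Lemma slope_lt X phi c : diskD X ->
  (slope X phi < c) = (dheight X phi - c * (1 - height X phi) < 0).
Proof. by move=> DX; rewrite subr_lt0 /slope ltr_pdivrMr// subr_gt0 height_lt1. Qed.

Lemma interior_slope K Z phi : K `<=` @diskD R -> K^° Z ->
  (exists2 X, K X & slope Z phi < slope X phi) /\
  (exists2 X, K X & slope X phi < slope Z phi).
Proof.
move=> KD KZ; set c := slope Z phi.
have DZ : diskD Z by apply: KD; exact: interior_subset KZ.
have cZ : dheight Z phi - c * (1 - height Z phi) = 0.
  by rewrite /c /slope divfK ?subrr// gt_eqF// subr_gt0 height_lt1.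
have c2 : 0 < 1 + c ^+ 2 by rewrite ltr_pwDl// sqr_ge0.
(* The displacement has frame coordinates s (c, 1), that is s times the gradient of dheight - c (1 -
   height), the affine function that vanishes on the level line of Z. *)
have E s X : X = (s * c * cos phi - s * sin phi, s * c * sin phi + s * cos phi) ->
    forall e, dheight (Z.1 + e * X.1, Z.2 + e * X.2) phi -
      c * (1 - height (Z.1 + e * X.1, Z.2 + e * X.2) phi) = s * (e * (1 + c ^+ 2)).
  move=> -> e; rewrite dheight_translate height_translate height_frame dheight_frame.
  by rewrite -[LHS]subr0 -cZ; ring.
split.
- have [e e0 Ke] := interior_translate K Z
    (1 * c * cos phi - 1 * sin phi, 1 * c * sin phi + 1 * cos phi) KZ.
  eexists; first exact: Ke.
  by rewrite (lt_slope _ _ _ (KD _ Ke)) (E 1)// mul1r mulr_gt0.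
- have [e e0 Ke] := interior_translate K Z
    (-1 * c * cos phi - -1 * sin phi, -1 * c * sin phi + -1 * cos phi) KZ.
  eexists; first exact: Ke.
  by rewrite (slope_lt _ _ _ (KD _ Ke)) (E (-1))// mulN1r oppr_lt0 mulr_gt0.
Qed.

(** X - R(phi) has coordinate [dheight] along e(phi) and 1 - [height] > 0 along the inward normal.
    Hence [ccw_angle] is in its [acos] branch, and the cotangent of the angle is the slope. *)
Lemma psi_atan X phi : diskD X -> Defs.psi X phi = pi / 2 - atan (slope X phi).
Proof.
move=> DX; have v0 : 0 < 1 - height X phi by rewrite subr_gt0 height_lt1.
have e := sin2cos2 phi.
have dE : dot (ept phi) (psub X (Rpt phi)) = dheight X phi.
  by rewrite /dot/= /dheight; ring.
have cE : cross (ept phi) (psub X (Rpt phi)) = 1 - height X phi.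
  by rewrite /cross/= /height; ring: e.
have eE : enorm (ept phi) = 1.
  by rewrite /enorm -[RHS]sqrtr1; congr Num.sqrt; rewrite /dot/=; ring: e.
have nE : dot (psub X (Rpt phi)) (psub X (Rpt phi)) =
          (1 - height X phi) ^+ 2 + dheight X phi ^+ 2.
  by rewrite /dot/= /height /dheight; ring: e.
rewrite /Defs.psi /ccw_angle dE cE eE (ltW v0) mul1r /enorm nE.
set t := atan (slope X phi).
have c0 : 0 < cos t by apply: cos_gt0_pihalf; rewrite atan_gtNpi2 atan_ltpi2.
have sE : dheight X phi * cos t = sin t * (1 - height X phi).
  have : tan t = slope X phi by rewrite atanK.
  rewrite /tan /slope => /eqP; rewrite eqr_div ?lt0r_neq0// => /eqP ->.
  by [].
have -> : (1 - height X phi) ^+ 2 + dheight X phi ^+ 2 =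
          ((1 - height X phi) / cos t) ^+ 2.
  have -> : dheight X phi = sin t * (1 - height X phi) / cos t.
    by rewrite -sE mulfK// gt_eqF.
  have e' := sin2cos2 t; apply: (mulIf (expf_neq0 2 (lt0r_neq0 c0))).
  have c1 : cos t != 0 by rewrite gt_eqF.
  have -> : ((1 - height X phi) / cos t) ^+ 2 * cos t ^+ 2 = (1 - height X phi) ^+ 2.
    by field.
  have -> : ((1 - height X phi) ^+ 2 + (sin t * (1 - height X phi) / cos t) ^+ 2)
      * cos t ^+ 2 = (1 - height X phi) ^+ 2 * (cos t ^+ 2 + sin t ^+ 2) by field.
  by rewrite cos2Dsin2 mulr1.
rewrite sqrtr_sqr ger0_norm ?divr_ge0 ?ltW//.
have -> : dheight X phi / ((1 - height X phi) / cos t) = sin t.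
  by rewrite invf_div mulrA sE mulfK// gt_eqF.
rewrite -cosBpihalf -cosN opprB cosK// in_itv/=.
by have := atan_ltpi2 (slope X phi); have := atan_gtNpi2 (slope X phi);
  have := pi_gt0 R; rewrite -/t => *; apply/andP; split; lra.
Qed.
End SupportDistance.

(** * The signed distance to the support line: sinh r is the maximal slope *)

Section SignedDistance.
Context {R : realType}.
Local Notation pt := (R * R)%type.
Implicit Types (X Y Z V : pt) (K : set pt) (phi : R).

Lemma hdist0 X : diskD X ->
  hdist (0, 0) X = ln ((1 + enorm X) / (1 - enorm X)) / 2.
Proof.
move=> DX; have [<-|X0] := eqVneq (0, 0) X.
  by rewrite /hdist eqxx /enorm /dot/= mulr0 addr0 sqrtr0 addr0 subr0 divr1 ln1 mul0r.
have D0 : diskD ((0, 0) : pt) by rewrite /diskD/dot/= mulr0 addr0.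
have [A [B [p [q [A1 B1 [/andP[p0 pq] q1] [OE XE] hE]]]]] := hdist_chord _ X D0 DX X0.
move: OE; rewrite /chord_pt => -[e1 e2].
have eA1 : (1 - p) * A.1 = - (p * B.1) by lra.
have eA2 : (1 - p) * A.2 = - (p * B.2) by lra.
(* The chord through O is a diameter: (1 - p) A = - p B with |A| = |B| = 1. Hence |X| = 2 q - 1, and
   the distance is artanh |X|. *)
have p2 : p = 1 / 2.
  have : (1 - p) ^+ 2 * dot A A = p ^+ 2 * dot B B.
    have -> : (1 - p) ^+ 2 * dot A A = ((1 - p) * A.1) ^+ 2 + ((1 - p) * A.2) ^+ 2.
      by rewrite /dot; ring.
    by rewrite eA1 eA2 /dot; ring.
  by rewrite A1 B1; lra.
have nX : enorm X = 2 * q - 1.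
  rewrite /enorm -[RHS]ger0_norm; last lra.
  rewrite -sqrtr_sqr; congr Num.sqrt; rewrite XE.
  have -> : dot (chord_pt A B q) (chord_pt A B q) = (1 - q) ^+ 2 * dot A A +
      2 * q * (1 - q) * dot A B + q ^+ 2 * dot B B by rewrite /dot /chord_pt/=; ring.
  have -> : dot A B = - dot B B.
    move: eA1 eA2; rewrite p2 /dot => eA1 eA2.
    have -> : A.1 = - B.1 by lra.
    have -> : A.2 = - B.2 by lra.
    ring.
  by rewrite A1 B1; ring.
have -> : hdist (0, 0) X = 2 * hdist (0, 0) X / 2 by field.
rewrite hE nX; congr (ln _ / 2); rewrite p2; field; lra.
Qed.

Lemma le_artanh (r s : R) : 0 <= r -> r <= s -> s < 1 ->
  ln ((1 + r) / (1 - r)) / 2 <= ln ((1 + s) / (1 - s)) / 2.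
Proof.
move=> r0 rs s1; rewrite ler_pM2r ?invr_gt0// ler_ln ?posrE ?divr_gt0//; try lra.
rewrite ler_pdivrMr; last lra.
by rewrite mulrAC ler_pdivlMr; lra.
Qed.

Lemma sinh_artanh (s c : R) : 0 <= s -> 0 < c -> s ^+ 2 + c ^+ 2 = 1 ->
  sinh (ln ((1 + s) / (1 - s)) / 2) = s / c.
Proof.
move=> s0 c0 sc; have s1 : s < 1 by nra.
have c1 : c != 0 by rewrite gt_eqF.
have s2 : 1 - s != 0 by rewrite gt_eqF// subr_gt0.
have s3 : 1 + s != 0 by rewrite gt_eqF//; lra.
have -> : (1 + s) / (1 - s) = ((1 + s) / c) ^+ 2.
  have -> : ((1 + s) / c) ^+ 2 = (1 + s) ^+ 2 / c ^+ 2 by field.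
  have -> : c ^+ 2 = (1 - s) * (1 + s) by lra.
  by field; rewrite s2 s3.
have u0 : 0 < (1 + s) / c by rewrite divr_gt0//; lra.
rewrite lnXn// mulr2n.
have -> : (ln ((1 + s) / c) + ln ((1 + s) / c)) / 2 = ln ((1 + s) / c) by field.
rewrite /sinh expRN lnK ?posrE//.
have -> : ((1 + s) / c)^-1 = (1 - s) / c.
  rewrite invf_div; apply/eqP; rewrite eqr_div//; apply/eqP.
  by lra.
by field.
Qed.

Section Compact.
Variable K : set pt.
Hypotheses (K0 : K !=set0) (cK : compact K) (KD : K `<=` @diskD R).

Lemma psi1_atan phi : psi1 K phi = pi / 2 - atan (max_slope K phi).
Proof.
have [X KX [-> Xmax]] := max_slope_ex K K0 cK KD phi; rewrite /psi1.
have lb Y : K Y -> pi / 2 - atan (slope X phi) <= Defs.psi Y phi.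
  move=> KY; rewrite (psi_atan _ _ (KD _ KY)) lerD2l lerN2.
  by have := Xmax _ KY; rewrite !le_eqVlt => /predU1P[->|/lt_atan ->]; rewrite ?eqxx ?orbT.
rewrite -(psi_atan _ _ (KD _ KX)).
apply/le_anti/andP; split.
  apply: ge_inf; last by exists X.
  by exists (pi / 2 - atan (slope X phi)) => _ [Y KY <-]; exact: lb.
apply: lb_le_inf; first by exists (Defs.psi X phi), X.
by move=> _ [Y KY <-]; rewrite (psi_atan _ _ (KD _ KX)); exact: lb.
Qed.

Lemma lam_dirE phi (t := atan (max_slope K phi)) : lam_dir K phi =
  (- sin t * sin phi - cos t * cos phi, sin t * cos phi - cos t * sin phi).
Proof.
rewrite /lam_dir psi1_atan -/t.
have -> : pi / 2 - t = - (t - pi / 2) by ring.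
rewrite cosN sinN cosBpihalf sinBpihalf /padd /pscale /psub /Rpt /ept/=.
by congr pair; ring.
Qed.

(** The first two factors are positive, so the side of the support line is the sign of v - slope. At
    O the slope is 0, which leaves the sign of v. *)
Lemma sideE phi X (v := max_slope K phi) : diskD X ->
  side K phi X = cos (atan v) * (1 - height X phi) * (v - slope X phi).
Proof.
move=> DX; rewrite /side lam_dirE -/v.
have v0 : 1 - height X phi != 0 by rewrite gt_eqF// subr_gt0 height_lt1.
have c0 : cos (atan v) != 0.
  by rewrite gt_eqF// cos_gt0_pihalf// atan_gtNpi2 atan_ltpi2.
have -> : cos (atan v) * (1 - height X phi) * (v - slope X phi) =
    v * cos (atan v) * (1 - height X phi) - cos (atan v) * dheight X phi.
  by rewrite /slope; field.
have -> : v * cos (atan v) = sin (atan v) by rewrite -{1}[v]atanK /tan divfK.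
have e := sin2cos2 phi.
by rewrite /cross /height /dheight/=; ring: e.
Qed.

Lemma hdist_O_lineE phi (s := `|sin (atan (max_slope K phi))|) :
  hdist_O_line K phi = ln ((1 + s) / (1 - s)) / 2.
Proof.
rewrite {}/s; set t := atan _.
have c0 : 0 < cos t by apply: cos_gt0_pihalf; rewrite atan_gtNpi2 atan_ltpi2.
have e1 := cos2Dsin2 t.
have [s0 ss] : 0 <= `|sin t| /\ `|sin t| ^+ 2 = sin t ^+ 2.
  by rewrite normr_ge0 real_normK ?num_real.
set s := `|sin t| in s0 ss *.
have s1 : s < 1.
  rewrite -(@ltr_pXn2r _ 2)// ?nnegrE// expr1n ss -e1 ltrDr.
  by rewrite exprn_gt0.
pose r X := ln ((1 + enorm X) / (1 - enorm X)) / 2.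
pose P (u : R) := padd (Rpt phi) (pscale u (lam_dir K phi)).
(* Pythagoras for the unit direction [lam_dir]: the foot of the perpendicular from O is at u = cos
   t, at Euclidean distance |sin t|, and artanh is increasing. *)
have nP u : dot (P u) (P u) = (u - cos t) ^+ 2 + s ^+ 2.
  rewrite ss /P lam_dirE -/t /dot/=.
  have e2 := sin2cos2 phi; have e3 := sin2cos2 t.
  by ring: e2 e3.
have sP u : s <= enorm (P u).
  rewrite -(ger0_norm s0) -sqrtr_sqr /enorm nP ler_sqrt ?addr_ge0 ?sqr_ge0//.
  by rewrite lerDr sqr_ge0.
have nPc : enorm (P (cos t)) = s.
  by rewrite /enorm nP subrr expr0n add0r sqrtr_sqr ger0_norm.
have DPc : diskD (P (cos t)).
  rewrite /diskD/= nP subrr expr0n add0r ss -e1 ltrDr exprn_gt0//.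
have ub X : (lambda1 K phi `&` @diskD R) X -> ln ((1 + s) / (1 - s)) / 2 <= hdist (0, 0) X.
  move=> [[u ->] DX]; rewrite (hdist0 _ DX); apply: le_artanh => //; first exact: sP.
  by move: DX; rewrite /diskD/= -(ltr_sqrt _ ltr01) sqrtr1.
rewrite /hdist_O_line; apply/le_anti/andP; split.
  rewrite -nPc -(hdist0 _ DPc); apply: ge_inf; last first.
    by exists (P (cos t)) => //; split=> //; exists (cos t).
  by exists (ln ((1 + s) / (1 - s)) / 2) => _ [X HX <-]; exact: ub.
apply: lb_le_inf; last by move=> _ [X HX <-]; exact: ub.
by exists (hdist (0, 0) (P (cos t))), (P (cos t)) => //; split=> //; exists (cos t).
Qed.

Lemma sinh_hdist_O_line phi : sinh (hdist_O_line K phi) = `|max_slope K phi|.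
Proof.
rewrite hdist_O_lineE; set v := max_slope K phi.
have c0 : 0 < cos (atan v) by apply: cos_gt0_pihalf; rewrite atan_gtNpi2 atan_ltpi2.
rewrite (sinh_artanh _ (cos (atan v)))//.
  by rewrite -(ger0_norm (ltW c0)) -normf_div -/(tan _) atanK.
by rewrite real_normK ?num_real// addrC cos2Dsin2.
Qed.

Lemma sinh_r_signed phi : K^° !=set0 -> sinh (r_signed K phi) = max_slope K phi.
Proof.
move=> [Z KZ]; set v := max_slope K phi.
have O0 : diskD ((0, 0) : pt) by rewrite /diskD/dot/= mulr0 addr0.
have c0 : 0 < cos (atan v) by apply: cos_gt0_pihalf; rewrite atan_gtNpi2 atan_ltpi2.
have sO : side K phi (0, 0) = cos (atan v) * v.
  rewrite sideE// -/v /slope /height /dheight/=.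
  by rewrite !(mul0r, addr0, subr0, mulr1).
have sI X : K^° X -> 0 < side K phi X.
  move=> KX; have KX' := interior_subset KX.
  have [[Y KY XY] _] := interior_slope K X phi KD KX.
  rewrite sideE; last exact: KD.
  rewrite !mulr_gt0// ?subr_gt0 ?height_lt1//; first exact: KD.
  exact: lt_le_trans XY (slope_le_max K K0 cK KD phi _ KY).
rewrite /r_signed sO; case: ifPn => [|v0].
  by rewrite mulf_eq0 gt_eqF//= => /eqP ->; rewrite /sinh oppr0 subrr mul0r.
(* [side] is positive on the interior, so the test amounts to v > 0; the interior point Z keeps it
   from holding vacuously. *)
case: asboolP => H.
  rewrite sinh_hdist_O_line ger0_norm// -(pmulr_rge0 _ c0).
  by have := H _ KZ; rewrite pmulr_lgt0 ?sI// => /ltW.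
have -> : forall x : R, sinh (- x) = - sinh x.
  by move=> x; rewrite /sinh opprK -mulNr opprB.
rewrite sinh_hdist_O_line ler0_norm ?opprK//.
rewrite leNgt; apply/negP => vp; apply: H => X KX.
by rewrite !mulr_gt0// sI.
Qed.
End Compact.
End SignedDistance.

(** * Convexity: boundary points on a line through an ideal point *)

Section ConvexLevels.
Context {R : realType}.
Local Notation pt := (R * R)%type.
Implicit Types (X Y Z P Q : pt) (K : set pt) (phi c t : R).

Definition mix t X Y : pt := (t * X.1 + (1 - t) * Y.1, t * X.2 + (1 - t) * Y.2).

Lemma convex_mix K X Y t : convex_set K -> K X -> K Y -> 0 <= t -> t <= 1 ->
  K (mix t X Y).
Proof.
move=> cvK KX KY t0 t1.
by have := cvK X Y (Itv01 t0 t1); rewrite !inE => /(_ KX KY).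
Qed.

Lemma interior_mix K Z X t : convex_set K -> K^° Z -> K X -> 0 < t -> t <= 1 ->
  K^° (mix t Z X).
Proof.
move=> cvK KZ KX t0 t1; set W := mix t Z X.
have tn0 : t != 0 by rewrite gt_eqF.
(* Inverse of the homothety with centre X and ratio t. It sends W to Z, so the preimage of K is a
   neighbourhood of W, and convexity puts that preimage inside K. *)
pose f (Y : pt) : pt := ((Y.1 - (1 - t) * X.1) / t, (Y.2 - (1 - t) * X.2) / t).
have fW : f W = (Z.1, Z.2) by rewrite /f /W /mix/=; congr pair; field.
have H (p : pt -> R) a : p Y @[Y --> W] --> p W -> (p Y - a) / t @[Y --> W] --> (p W - a) / t.
  by move=> pc; apply: cvgM; [apply: cvgB => //; exact: cvg_cst|exact: cvg_cst].
have fc : f Y @[Y --> W] --> f W.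
  exact: (cvg_pair (H fst _ cvg_fst) (H snd _ cvg_snd)).
rewrite fW -surjective_pairing in fc.
have KW : nbhs W (f @^-1` K) by exact: (fc _ KZ).
apply: (filterS _ KW) => Y /= KfY.
have -> : Y = mix t (f Y) X.
  by rewrite [LHS]surjective_pairing /mix /f/=; congr pair; field.
by apply: convex_mix => //; exact: ltW.
Qed.

Lemma height_mix t X Y phi :
  height (mix t X Y) phi = t * height X phi + (1 - t) * height Y phi.
Proof. by rewrite /height/=; ring. Qed.

Lemma dheight_mix t X Y phi :
  dheight (mix t X Y) phi = t * dheight X phi + (1 - t) * dheight Y phi.
Proof. by rewrite /dheight/=; ring. Qed.

Lemma height_dheight_inj X Y phi :
  height X phi = height Y phi -> dheight X phi = dheight Y phi -> X = Y.
Proof.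
rewrite /height /dheight => e1 e2; have e := sin2cos2 phi.
rewrite (surjective_pairing X) (surjective_pairing Y); congr pair.
  have -> : X.1 = (X.1 * cos phi + X.2 * sin phi) * cos phi -
                  (X.2 * cos phi - X.1 * sin phi) * sin phi by ring: e.
  by rewrite e1 e2; ring: e.
have -> : X.2 = (X.1 * cos phi + X.2 * sin phi) * sin phi +
                (X.2 * cos phi - X.1 * sin phi) * cos phi by ring: e.
by rewrite e1 e2; ring: e.
Qed.

Lemma slope_eq X phi c : diskD X ->
  slope X phi = c <-> dheight X phi = c * (1 - height X phi).
Proof.
move=> DX; have v0 : 1 - height X phi != 0 by rewrite gt_eqF// subr_gt0 height_lt1.
by split => [<-|E]; rewrite /slope ?divfK// E mulfK.
Qed.

Section Convex.
Variable K : set pt.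
Hypotheses (cvK : convex_set K) (KD : K `<=` @diskD R).

(** Level c is the zero line of the affine function [G], which has opposite signs at X and Y. From Z
    one moves towards the one with sign opposite to Z; before the far end such a segment stays in
    the interior. *)
Lemma interior_level X Y Z phi c : K^° Z -> K X -> K Y ->
  slope X phi < c -> c < slope Y phi -> exists2 W, K^° W & slope W phi = c.
Proof.
move=> KZ KX KY; have KZ' := interior_subset KZ.
rewrite (slope_lt _ _ _ (KD _ KX)) (lt_slope _ _ _ (KD _ KY)).
pose G P := dheight P phi - c * (1 - height P phi).
rewrite -/(G X) -/(G Y) => GX GY.
have Gmix t P Q : G (mix t P Q) = t * G P + (1 - t) * G Q.
  by rewrite /G height_mix dheight_mix; ring.
have G0 W : K^° W -> G W = 0 -> exists2 W, K^° W & slope W phi = c.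
  move=> KW GW; exists W => //; apply/slope_eq; first by apply: KD; exact: interior_subset.
  by apply/eqP; rewrite -subr_eq0; apply/eqP.
have mid P : K P -> G P * G Z < 0 -> exists2 W, K^° W & slope W phi = c.
  move=> KP GPZ; have GPZ0 : G P != G Z.
    by apply: contraTneq GPZ => ->; rewrite -leNgt -expr2 sqr_ge0.
  have GPZ1 : G P - G Z != 0 by rewrite subr_eq0.
  (* The weight on Z at which t G(Z) + (1 - t) G(P) = 0; its positivity makes the point interior. *)
  have tE : 0 < G P / (G P - G Z) <= 1.
    have -> : G P / (G P - G Z) = (G P ^+ 2 - G P * G Z) / (G P - G Z) ^+ 2.
      by field.
    have q0 : 0 < (G P - G Z) ^+ 2 by rewrite exprn_even_gt0.
    rewrite divr_gt0//=; last by have := sqr_ge0 (G P); lra.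
    by rewrite ler_pdivrMr// mul1r; have := sqr_ge0 (G Z); lra.
  case/andP: tE => t0 t1; apply: (G0 (mix (G P / (G P - G Z)) Z P)).
    exact: interior_mix.
  by rewrite Gmix; field.
have [GZ|GZ|GZ] := ltgtP (G Z) 0; last exact: (G0 Z).
- by apply: (mid Y) => //; rewrite nmulr_llt0.
- by apply: (mid X) => //; rewrite pmulr_llt0.
Qed.

(** On the line slope = c a point is fixed by its height. The sign condition puts P between Z and Q,
    and P differs from Q, so P is a mixture with positive weight on the interior point Z. *)
Lemma boundary_between Z P Q phi c : K^° Z -> K Q -> K P ->
  slope Z phi = c -> slope P phi = c -> slope Q phi = c ->
  0 <= (height P phi - height Z phi) * (height Q phi - height P phi) ->
  height P phi != height Q phi -> K^° P.
Proof.
move=> KZ KQ KP; have DZ : diskD Z by apply: KD; exact: interior_subset.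
move=> /(slope_eq _ _ _ DZ) zE /(slope_eq _ _ _ (KD _ KP)) pE /(slope_eq _ _ _ (KD _ KQ)) qE.
set z := height Z phi; set p := height P phi; set q := height Q phi => zpq pq.
have qp : q - p != 0 by rewrite subr_eq0 eq_sym.
have qp2 : 0 < (q - p) ^+ 2 by rewrite exprn_even_gt0.
have qz2 : 0 < (q - p) * (q - z).
  have -> : (q - p) * (q - z) = (q - p) ^+ 2 + (p - z) * (q - p) by ring.
  by rewrite ltr_pwDl.
have qz : q - z != 0 by apply: contraTneq qz2 => ->; rewrite mulr0 ltxx.
have qz3 : 0 < (q - z) ^+ 2 by rewrite exprn_even_gt0.
have tE : (q - p) / (q - z) = ((q - p) * (q - z)) / (q - z) ^+ 2 by field.
have -> : P = mix ((q - p) / (q - z)) Z Q.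
  have hm : height P phi = height (mix ((q - p) / (q - z)) Z Q) phi.
    by rewrite height_mix -/z -/p -/q; field.
  apply: (height_dheight_inj _ _ phi hm).
  by rewrite pE hm dheight_mix height_mix zE qE; ring.
apply: interior_mix => //; rewrite tE; first by rewrite divr_gt0.
rewrite ler_pdivrMr// mul1r.
have -> : (q - z) ^+ 2 = (q - p) * (q - z) + (p - z) * (q - p) + (p - z) ^+ 2 by ring.
by have := sqr_ge0 (p - z); lra.
Qed.

(** As c is strictly between two attained slopes, the level line contains an interior point W. Each
    of the two half-lines from W carries at most one boundary point, and two of the three points
    share a half-line. *)
Lemma boundary_level_two X Y P1 P2 P3 phi c : K^° !=set0 -> K X -> K Y ->
  slope X phi < c -> c < slope Y phi ->
  (K `\` K^°) P1 -> (K `\` K^°) P2 -> (K `\` K^°) P3 ->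
  slope P1 phi = c -> slope P2 phi = c -> slope P3 phi = c ->
  [\/ P1 = P2, P2 = P3 | P3 = P1].
Proof.
move=> [Z KZ] KX KY Xc cY B1 B2 B3 s1 s2 s3.
have [W KW sW] := interior_level _ _ _ _ _ KZ KX KY Xc cY.
have lt_side P Q : (K `\` K^°) P -> (K `\` K^°) Q -> slope P phi = c ->
    slope Q phi = c -> (height W phi <= height P phi) = (height W phi <= height Q phi) ->
    height P phi < height Q phi -> False.
  move=> [KP nP] [KQ nQ] sP sQ E PQ.
  have [WP|PW] := leP (height W phi) (height P phi).
    apply: nP; apply: (boundary_between W P Q phi c) => //.
      by rewrite mulr_ge0// subr_ge0// ltW.
    by rewrite lt_eqF.
  have QW : height Q phi < height W phi by rewrite ltNge -E -ltNge.
  apply: nQ; apply: (boundary_between W Q P phi c) => //.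
    by rewrite mulr_le0// subr_le0 ltW.
  by rewrite gt_eqF.
have same_side P Q : (K `\` K^°) P -> (K `\` K^°) Q -> slope P phi = c ->
    slope Q phi = c -> (height W phi <= height P phi) = (height W phi <= height Q phi) ->
    P = Q.
  move=> BP BQ sP sQ E.
  have hE : height P phi = height Q phi.
    have [/(lt_side _ _ BP BQ sP sQ E)//|H|//] := ltgtP (height P phi) (height Q phi).
    by case: (lt_side _ _ BQ BP sQ sP (esym E) H).
  apply: (height_dheight_inj _ _ phi hE).
  move/(slope_eq _ _ _ (KD _ BP.1)) : sP => ->.
  by move/(slope_eq _ _ _ (KD _ BQ.1)) : sQ => ->; rewrite hE.
have h12 := same_side _ _ B1 B2 s1 s2; have h23 := same_side _ _ B2 B3 s2 s3.
have h31 := same_side _ _ B3 B1 s3 s1.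
move: h12 h23 h31.
by case: (_ <= height P1 phi); case: (_ <= height P2 phi); case: (_ <= height P3 phi);
  move=> h12 h23 h31; (exact: (Or31 _ _ (h12 erefl)) ||
    exact: (Or32 _ _ (h23 erefl)) || exact: (Or33 _ _ (h31 erefl))).
Qed.

End Convex.
End ConvexLevels.

(** * Upper bound for chord sums by counting levels *)

Section ChordSums.
Context {R : realType}.
Local Notation pt := (R * R)%type.
Notation mu := (@lebesgue_measure R).

(** Integrate over c in [m, M] the number of open intervals that contain c: a finite form of the
    Banach indicatrix. *)
Lemma sum_lengths_le (n k : nat) (a b : 'I_n -> R) (m M : R) : m <= M ->
  (forall i, m <= a i /\ a i <= b i /\ b i <= M) ->
  (forall c, (#|[pred i | (a i < c < b i)%R]| <= k)%N) ->
  \sum_(i < n) (b i - a i) <= k%:R * (M - m).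
Proof.
move=> mM abM Hk; rewrite -lee_fin -sumEFin.
have mumM : mu `[m, M] = (M - m)%:E.
  by rewrite lebesgue_measure_itv/= lte_fin; case: ltgtP mM => // -> _; rewrite subrr.
have -> : ((k%:R * (M - m))%:E = \int[mu]_(x in `[m, M]) (k%:R)%:E)%E.
  by rewrite integral_cst// EFinM -mumM.
have -> : (\sum_(i < n) (b i - a i)%:E =
    \int[mu]_(x in `[m, M]) (\sum_(i < n) (\1_(`]a i, b i[) x)%:E))%E.
  rewrite ge0_integral_sum//; last 
    by move=> i; apply/measurable_realfun.measurable_EFinP;
      exact: measurable_realfun.measurable_indic.
  apply: eq_bigr => i _; have [mi [ii iM]] := abM i.
  rewrite integral_indic// setIidl; last first.
    move=> x/=; rewrite !in_itv/= => /andP[ax xb].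
    by rewrite (le_trans mi (ltW ax)) (le_trans (ltW xb) iM).
  have <- : mu `]a i, b i[ = (b i - a i)%:E.
    by rewrite lebesgue_measure_itv/= lte_fin; case: ltgtP ii => // -> _; rewrite subrr.
  by [].
apply: ge0_le_integral => //.
- by move=> x _; apply: sume_ge0 => i _; rewrite lee_fin.
- apply: emeasurable_sum => i; apply/measurable_realfun.measurable_EFinP.
  exact: measurable_realfun.measurable_indic.
- move=> c _; rewrite sumEFin lee_fin.
  rewrite (_ : \sum_(i < n) _ = (\sum_(i < n) (a i < c < b i)%R)%:R).
    rewrite ler_nat; apply: leq_trans (Hk c); rewrite -sum1_card [leqRHS]big_mkcond/=.
    by apply: leq_sum => i _; rewrite inE; case: (_ && _).
  rewrite natr_sum; apply: eq_bigr => i _.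
  by rewrite indicE mem_setE in_itv.
Qed.

Lemma subdivision_le (n : nat) (t : nat -> R) :
  (forall i, (i < n)%N -> t i < t i.+1) ->
  forall i j, (i <= j)%N -> (j <= n)%N -> t i <= t j.
Proof.
move=> tlt i j; elim: j => [|j IH]; first by rewrite leqn0 => /eqP ->.
rewrite leq_eqVlt => /predU1P[->//|ij jn].
by rewrite (le_trans (IH ij (ltnW jn)))// ltW// tlt.
Qed.

Section BoundaryCurve.
Variables (K : set pt) (gamma : R -> pt).
Hypotheses (cK : compact K) (cvK : convex_set K) (iK : K^° !=set0).
Hypotheses (KD : K `<=` @diskD R) (gammaK : param_boundary K gamma).

Let K0 : K !=set0.
Proof. by have [Z /interior_subset KZ] := iK; exists Z. Qed.

Lemma boundary_compact : boundary K = K `\` K^°.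
Proof.
rewrite /boundary; congr (_ `\` _); apply/esym/closure_id.
exact: compact_closed (@norm_hausdorff R (R * R)%type) cK.
Qed.

Lemma gamma_boundary t : 0 <= t -> t <= 1 -> (K `\` K^°) (gamma t).
Proof.
have [_ [_ [_ gK]]] := gammaK => t0 t1.
by rewrite -boundary_compact -gK; exists t => //=; rewrite in_itv/= t0.
Qed.

Lemma slope_gamma_continuous phi :
  {within `[0, 1], continuous (fun t => slope (gamma t) phi)}.
Proof.
have [/subspace_continuousP cg _] := gammaK; apply/subspace_continuousP => t t01.
have gt := cg t t01.
have [t0 t1] : 0 <= t /\ t <= 1 by move: t01; rewrite /= in_itv/= => /andP[].
have sl := continuous_slope_point phi (gamma t) (KD _ (gamma_boundary t t0 t1).1).
exact: (cvg_comp _ _ gt sl).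
Qed.

Lemma sum_slope_le (n : nat) (t : nat -> R) phi : t 0%N = 0 -> t n = 1 ->
  (forall i, (i < n)%N -> t i < t i.+1) ->
  \sum_(i < n) `|slope (gamma (t i)) phi - slope (gamma (t i.+1)) phi| <=
  2 * (max_slope K phi - min_slope K phi).
Proof.
move=> t0 tn tlt; have tmono := subdivision_le n t tlt.
have tge i : (i <= n)%N -> 0 <= t i by move=> ilen; rewrite -t0 tmono.
have tle i : (i <= n)%N -> t i <= 1 by move=> ilen; rewrite -tn tmono.
pose g s := slope (gamma s) phi.
have Kg s : 0 <= s -> s <= 1 -> K (gamma s) by move=> s0 s1; exact: (gamma_boundary s s0 s1).1.
pose a (i : 'I_n) := Num.min (g (t i)) (g (t i.+1)).
pose b (i : 'I_n) := Num.max (g (t i)) (g (t i.+1)).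
have -> : \sum_(i < n) `|slope (gamma (t i)) phi - slope (gamma (t i.+1)) phi| =
    \sum_(i < n) (b i - a i).
  apply: eq_bigr => i _; rewrite /b /a -/(g (t i)) -/(g (t i.+1)).
  have [h|h] := leP (g (t i)) (g (t i.+1)); first by rewrite ler0_norm ?opprB ?subr_le0.
  by rewrite gtr0_norm ?subr_gt0.
have gmM s : 0 <= s -> s <= 1 -> min_slope K phi <= g s <= max_slope K phi.
  move=> s0 s1; rewrite min_le_slope ?slope_le_max//; exact: Kg.
have mM : min_slope K phi <= max_slope K phi.
  by have /andP[/le_trans] := gmM 0 (lexx _) ler01; apply.
apply: sum_lengths_le => //.
  move=> i; have /andP[m1 M1] := gmM _ (tge i (ltnW (ltn_ord i))) (tle i (ltnW (ltn_ord i))).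
  have /andP[m2 M2] := gmM _ (tge i.+1 (ltn_ord i)) (tle i.+1 (ltn_ord i)).
  split; first by rewrite /a le_min m1.
  by split; [rewrite /a /b ge_min !le_max lexx|rewrite /b ge_max M1].
move=> c; rewrite leqNgt; apply/negP => /card_gt2P.
(* Strictness on both sides matters: parameters from different pieces are distinct and lie in [0,
   1[, where [gamma] is injective, so three pieces would give three distinct boundary points at
   level c. *)
have hit (i : 'I_n) : a i < c < b i -> exists2 s, t i < s < t i.+1 & g s = c.
  move=> /andP[ac cb]; have ti := tlt i (ltn_ord i).
  have sub : `[t i, t i.+1] `<=` (`[0, 1] : set R).
    move=> s; rewrite /= !in_itv/= => /andP[s1 s2].
    by rewrite (le_trans _ s1) ?tge ?(le_trans s2) ?tle// ltnW.
  have [|s] := @IVT R g _ _ c (ltW ti) (continuous_subspaceW sub (slope_gamma_continuous phi)).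
    by rewrite (ltW ac) (ltW cb).
  rewrite in_itv/= => /andP[s1 s2] gs; exists s => //.
  rewrite !lt_neqAle s1 s2 !andbT; apply/andP; split; apply/eqP => E.
    move: ac cb; rewrite /a /b E gs gt_min lt_max !ltxx/= => u v.
    by have := lt_trans u v; rewrite ltxx.
  move: ac cb; rewrite /a /b -E gs gt_min lt_max !ltxx !orbF => u v.
  by have := lt_trans u v; rewrite ltxx.
have sep (i j : 'I_n) s s' : (i < j)%N -> t i < s < t i.+1 -> t j < s' < t j.+1 -> s < s'.
  move=> ij /andP[_ si] /andP[sj _]; rewrite (lt_trans si)// (le_lt_trans _ sj)//.
  by rewrite tmono// ltnW.
have [_ [_ [ginj _]]] := gammaK.
have dist (i j : 'I_n) s s' : i != j -> t i < s < t i.+1 -> t j < s' < t j.+1 ->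
    gamma s <> gamma s'.
  move=> ij hs hs' E; have I01 (k : 'I_n) u : t k < u < t k.+1 -> u \in `[0, 1[.
    move=> /andP[u1 u2]; rewrite in_itv/= (le_trans _ (ltW u1)) ?tge ?(lt_le_trans u2) ?tle//.
    exact: ltnW.
  have ss := ginj s s' (I01 i s hs) (I01 j s' hs') E.
  move: ij; rewrite -val_eqE neq_ltn => /orP[ij|ji].
    by have := sep _ _ _ _ ij hs hs'; rewrite ss ltxx.
  by have := sep _ _ _ _ ji hs' hs; rewrite ss ltxx.
move=> [i [j [k [[ai aj ak] [ij jk ki]]]]].
have [si hi gi] := hit i ai; have [sj hj gj] := hit j aj; have [sk hk gk] := hit k ak.
have bd (l : 'I_n) u : t l < u < t l.+1 -> (K `\` K^°) (gamma u).
  move=> /andP[u1 u2]; apply: gamma_boundary.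
    by rewrite (le_trans _ (ltW u1))// tge// ltnW.
  by rewrite (le_trans (ltW u2))// tle.
have [X KX [XE _]] := min_slope_ex K K0 cK KD phi.
have [Y KY [YE _]] := max_slope_ex K K0 cK KD phi.
have /andP[ac cb] := ai.
have Kt (l : nat) : (l <= n)%N -> min_slope K phi <= g (t l) <= max_slope K phi.
  by move=> ln; rewrite gmM ?tge ?tle.
have /andP[m1 M1] := Kt i (ltnW (ltn_ord i)); have /andP[m2 M2] := Kt i.+1 (ltn_ord i).
have Xc : slope X phi < c by rewrite -XE (le_lt_trans _ ac)// /a le_min m1.
have cY : c < slope Y phi by rewrite -YE (lt_le_trans cb)// /b ge_max M1.
case: (boundary_level_two K cvK KD X Y _ _ _ phi c iK KX KY Xc cY (bd _ _ hi) (bd _ _ hj)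
  (bd _ _ hk) gi gj gk).
- exact: dist ij hi hj.
- exact: dist jk hj hk.
- exact: dist ki hk hi.
Qed.

End BoundaryCurve.
End ChordSums.

(** * Uniform continuity, variation of closed sequences, integrals of finite sums *)

Section LowerBound.
Context {R : realType}.
Local Notation pt := (R * R)%type.
Notation mu := (@lebesgue_measure R).

Lemma heine_segment (f : R -> R) (a b e : R) : {within `[a, b], continuous f} ->
  0 < e -> exists2 d, 0 < d & forall x y, x \in `[a, b] -> y \in `[a, b] ->
    `|x - y| < d -> `|f x - f y| < e.
Proof.
move=> /subspace_continuousP cf e0.
pose P (d x : R) := x \in `[a, b] -> forall y, y \in `[a, b] ->
  `|x - y| < d -> `|f x - f y| < e.
have /compact_near_coveringP covab := @segment_compact R a b.
have : \forall d \near (0 : R)^'+, `[a, b] `<=` P d.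
  apply: covab => x xab.
  have e2 : 0 < e / 2 by rewrite divr_gt0.
  have /cvgrPdist_lt /(_ _ e2) := cf x xab.
  rewrite near_withinE => /nbhs_ballP[r r0 Hr].
  have r2 : 0 < r / 2 by rewrite divr_gt0.
  exists (ball x (r / 2), [set d | d < r / 2]) => /=.
    by split; [exact: nbhsx_ballx|exact: nbhs_right_lt].
  move=> [u d] /= [xu dr] uab y yab uy.
  have xuE : `|f x - f u| < e / 2.
    apply: Hr => //; apply: lt_trans xu _; lra.
  have xyE : `|f x - f y| < e / 2.
    apply: Hr => //; rewrite /ball/= (le_lt_trans (ler_distD u _ _))//.
    by move: xu uy; rewrite /ball/=; lra.
  by rewrite (le_lt_trans (ler_distD (f x) _ _))// (distrC (f u)); lra.
move=> H; near ((0 : R)^'+) => d.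
have Hd : `[a, b] `<=` P d by near: d.
by exists d => // x y xab yab; exact: Hd.
Unshelve. all: by end_near. Qed.

(** A closed sequence travels between x j and x k twice, once directly and once through the common
    end value; this matches the factor 2 of the upper bound. *)
Lemma cyclic_variation (x : nat -> R) (n j k : nat) : x n = x 0%N ->
  (j <= n)%N -> (k <= n)%N ->
  2 * (x j - x k) <= \sum_(i < n) `|x i - x i.+1|.
Proof.
move=> xn jn kn.
have path a b : (a <= b)%N -> `|x a - x b| <= \sum_(a <= i < b) `|x i - x i.+1|.
  elim: b => [|b IH]; first by rewrite leqn0 => /eqP ->; rewrite subrr normr0 big_nil.
  rewrite leq_eqVlt => /predU1P[<-|ab]; first by rewrite subrr normr0 big_geq.
  by rewrite big_nat_recr//= (le_trans (ler_distD (x b) _ _))// lerD2r IH.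
have both a b : (a <= b)%N -> (b <= n)%N ->
    2 * `|x a - x b| <= \sum_(i < n) `|x i - x i.+1|.
  move=> ab bn; rewrite -(big_mkord xpredT (fun i => `|x i - x i.+1|)).
  rewrite (big_cat_nat (leq0n a) (leq_trans ab bn))/= (big_cat_nat ab bn)/=.
  have p1 := path 0%N a (leq0n a); have p2 := path a b ab; have p3 := path b n bn.
  rewrite xn in p3.
  have tri : `|x a - x b| <= `|x 0%N - x a| + `|x b - x 0%N|.
    by rewrite (le_trans (ler_distD (x 0%N) _ _))// (distrC (x a)) (distrC (x 0%N) (x b)).
  lra.
have [jk|/ltnW kj] := leqP j k.
  by rewrite (le_trans _ (both j k jk kn))// ler_pM2l// ler_norm.
by rewrite (le_trans _ (both k j kj jn))// ler_pM2l// distrC ler_norm.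
Qed.

Lemma integral_sum_continuous (n : nat) (F : nat -> R -> R) (a b : R) :
  (forall i, continuous (F i)) ->
  continuous (fun x => \sum_(i < n) F i x) /\
  \int[mu]_(x in `[a, b]) (\sum_(i < n) F i x) =
  \sum_(i < n) \int[mu]_(x in `[a, b]) F i x.
Proof.
move=> cF; elim: n => [|n [cS IH]].
  split; first by under eq_fun do rewrite big_ord0; exact: cst_continuous.
  by under eq_Rintegral do rewrite big_ord0; rewrite Rintegral_cst// mul0r big_ord0.
split.
  under eq_fun do rewrite big_ord_recr/=.
  by move=> x; apply: cvgD; [exact: cS|exact: cF].
under eq_Rintegral do rewrite big_ord_recr/=.
rewrite RintegralD//; first by rewrite IH big_ord_recr.
- exact: continuous_seg_integrable.
- exact: continuous_seg_integrable.
Qed.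
End LowerBound.

(** * The length of the boundary as the integral of the maximal slope *)

Section Perimeter.
Context {R : realType}.
Local Notation pt := (R * R)%type.
Notation mu := (@lebesgue_measure R).
Variables (K : set pt) (gamma : R -> pt).
Hypotheses (cK : compact K) (cvK : convex_set K) (iK : K^° !=set0).
Hypotheses (KD : K `<=` @diskD R) (gammaK : param_boundary K gamma).

Let K0 : K !=set0.
Proof. by have [Z /interior_subset KZ] := iK; exists Z. Qed.

(** By [interior_slope] no interior point of K is extremal, so the extremes over K are already
    reached on the curve. *)
Lemma extremal_on_gamma phi :
  (exists2 t, t \in `[0, 1] & slope (gamma t) phi = max_slope K phi) /\
  (exists2 t, t \in `[0, 1] & slope (gamma t) phi = min_slope K phi).
Proof.
have [_ [_ [_ gK]]] := gammaK.
have onb X : K X -> ~ K^° X -> exists2 t, t \in `[0, 1] & gamma t = X.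
  move=> KX nX; have : boundary K X by rewrite boundary_compact.
  by rewrite -gK => -[t t01 <-]; exists t.
split.
- have [X KX [-> Xmax]] := max_slope_ex K K0 cK KD phi.
  have [|t t01 <-] := onb X KX; last by exists t.
  move=> /(interior_slope K X phi KD)[[Y KY]].
  by rewrite ltNge Xmax.
- have [X KX [-> Xmin]] := min_slope_ex K K0 cK KD phi.
  have [|t t01 <-] := onb X KX; last by exists t.
  move=> /(interior_slope K X phi KD)[_ [Y KY]].
  by rewrite ltNge Xmin.
Qed.

(** One [d] must serve all phi, since the subdivision is fixed before integrating in phi. *)
Lemma slope_gamma_equicontinuous (e : R) : 0 < e -> exists2 d, 0 < d &
  forall x y, x \in `[0, 1] -> y \in `[0, 1] -> `|x - y| < d ->
  forall phi, `|slope (gamma x) phi - slope (gamma y) phi| <= e.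
Proof.
move=> e0; have [k k0 kK] := height_bound K K0 cK KD.
have [cg _] := gammaK.
have C0 : 0 < k^-1 + k ^- 2 by rewrite addr_gt0 ?invr_gt0 ?exprn_gt0.
have e1 : 0 < e / (k^-1 + k ^- 2) / 2 by rewrite !divr_gt0.
have c1 : {within `[0, 1], continuous (fst \o gamma)}.
  apply/subspace_continuousP => x x01.
  by move/subspace_continuousP : cg => /(_ x x01) /cvg_comp; apply; exact: cvg_fst.
have c2 : {within `[0, 1], continuous (snd \o gamma)}.
  apply/subspace_continuousP => x x01.
  by move/subspace_continuousP : cg => /(_ x x01) /cvg_comp; apply; exact: cvg_snd.
have [d1 d10 H1] := heine_segment _ 0 1 _ c1 e1.
have [d2 d20 H2] := heine_segment _ 0 1 _ c2 e1.
exists (Num.min d1 d2); first by rewrite lt_min d10.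
move=> x y x01 y01; rewrite lt_min => /andP[xy1 xy2] phi.
have Kg z : z \in `[0, 1] -> K (gamma z).
  by rewrite in_itv/= => /andP[z0 z1]; exact: (gamma_boundary K gamma cK gammaK z z0 z1).1.
have Kx := Kg x x01; have Ky := Kg y y01.
rewrite (le_trans (slope_lipschitz_point _ _ k phi (KD _ Kx) (KD _ Ky) k0
  (kK _ phi Kx) (kK _ phi Ky)))//.
rewrite mulrC -ler_pdivlMr//.
have := H1 x y x01 y01 xy1; have := H2 x y x01 y01 xy2; rewrite /=.
by move: (e / _) => E; lra.
Qed.

Lemma fine_subdivision (e : R) : 0 < e -> exists n (t : nat -> R),
  [/\ t 0%N = 0, t n = 1, (forall i, (i < n)%N -> t i < t i.+1) &
   forall phi, 2 * (max_slope K phi - min_slope K phi - e) <=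
     \sum_(i < n) `|slope (gamma (t i)) phi - slope (gamma (t i.+1)) phi|].
Proof.
move=> e0; have e2 : 0 < e / 2 by rewrite divr_gt0.
have [d d0 Hd] := slope_gamma_equicontinuous _ e2.
have [n] := ltr_add_invr d0; rewrite add0r => nd.
have n0 : 0 < n.+1%:R :> R by rewrite ltr0n.
pose t i : R := i%:R / n.+1%:R.
have near s : s \in `[0, 1] -> exists2 j, (j <= n.+1)%N & forall phi,
    `|slope (gamma s) phi - slope (gamma (t j)) phi| <= e / 2.
  rewrite in_itv/= => /andP[s0 s1].
  have sn0 : 0 <= s * n.+1%:R by rewrite mulr_ge0 // ltW.
  (* The node just below s in the uniform subdivision. The maximizer and the minimizer each lose at
     most e/2 by moving to such a node. *)
  have /andP[j1 j2] := Num.Theory.truncn_itv sn0.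
  set j := Num.trunc _ in j1 j2.
  have jn : (j <= n.+1)%N.
    rewrite -(ler_nat R) (le_trans j1)// -[leRHS]mul1r ler_pM2r//.
  exists j => // phi; apply: Hd.
  - by rewrite in_itv/= s0.
  - by rewrite in_itv/= /t divr_ge0 ?ler_pdivrMr ?mul1r ?ler_nat.
  - apply: le_lt_trans nd; rewrite /t.
    have -> : s - j%:R / n.+1%:R = (s * n.+1%:R - j%:R) / n.+1%:R by field; rewrite gt_eqF.
    rewrite ger0_norm ?divr_ge0 ?subr_ge0// ler_pdivrMr// mulVf ?gt_eqF//.
    by move: j2; rewrite -[j.+1%:R]natr1; lra.
exists n.+1, t; split.
- by rewrite /t mul0r.
- by rewrite /t divff// gt_eqF.
- by move=> i _; rewrite /t ltr_pM2r ?invr_gt0// ltr_nat.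
- move=> phi; have [[s s01 <-] [s' s'01 <-]] := extremal_on_gamma phi.
  have [j jn Hj] := near s s01; have [j' jn' Hj'] := near s' s'01.
  have [_ [g01 _]] := gammaK.
  have E : slope (gamma (t n.+1)) phi = slope (gamma (t 0%N)) phi.
    by rewrite /t mul0r divff ?gt_eqF// g01.
  apply: le_trans (cyclic_variation (fun i => slope (gamma (t i)) phi) n.+1 j j' E jn jn').
  have := Hj phi; have := Hj' phi; rewrite !ler_norml => /andP[a1 a2] /andP[b1 b2].
  by lra.
Qed.

Lemma sum_hdist_integral (n : nat) (t : nat -> R) : t 0%N = 0 -> t n = 1 ->
  (forall i, (i < n)%N -> t i < t i.+1) ->
  let S phi := \sum_(i < n) `|slope (gamma (t i)) phi - slope (gamma (t i.+1)) phi| in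
  continuous S /\ \int[mu]_(phi in `[0, 2 * pi]) S phi =
    4 * \sum_(i < n) hdist (gamma (t i)) (gamma (t i.+1)).
Proof.
move=> t0 tn tlt S; have tmono := subdivision_le n t tlt.
have Dg i : (i <= n)%N -> diskD (gamma (t i)).
  move=> ilen; apply: KD; apply: (gamma_boundary K gamma cK gammaK _ _ _).1.
    by rewrite -t0 tmono.
  by rewrite -tn tmono.
(* Extended by 0, since [integral_sum_continuous] asks for continuity at every index, while the
   nodes are known to lie in [0, 1] only up to n. *)
pose F i phi := if (i < n)%N then
  `|slope (gamma (t i)) phi - slope (gamma (t i.+1)) phi| else 0.
have cF i : continuous (F i).
  rewrite /F; have [i_n|_] := ltnP i n; last exact: cst_continuous.
  have c1 := continuous_slope _ (Dg i (ltnW i_n)).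
  have c2 := continuous_slope _ (Dg i.+1 i_n).
  by move=> x; apply: cvg_norm; apply: cvgB; [exact: c1|exact: c2].
have SE : S = fun phi => \sum_(i < n) F i phi.
  by apply/funext => phi; apply: eq_bigr => i _; rewrite /F ltn_ord.
have [cS IE] := integral_sum_continuous n F 0 (2 * pi) cF.
rewrite SE; split=> //; rewrite IE mulr_sumr; apply: eq_bigr => i _.
rewrite -crofton_hdist; [|exact: Dg (ltnW (ltn_ord i))|exact: Dg].
by apply: eq_Rintegral => phi _; rewrite /F ltn_ord.
Qed.

Lemma integral_width : \int[mu]_(phi in `[0, 2 * pi])
    (2 * (max_slope K phi - min_slope K phi)) =
  4 * \int[mu]_(phi in `[0, 2 * pi]) max_slope K phi.
Proof.
have [C HC] := max_slope_lipschitz K K0 cK KD.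
have [C' HC'] := min_slope_lipschitz K K0 cK KD.
have cM := lipschitz_continuous _ _ HC; have cm := lipschitz_continuous _ _ HC'.
have iM := continuous_seg_integrable _ 0 (2 * pi) cM.
have im := continuous_seg_integrable _ 0 (2 * pi) cm.
have cB : continuous (fun phi => max_slope K phi - min_slope K phi).
  by move=> x; apply: cvgB; [exact: cM|exact: cm].
rewrite RintegralZl//; last exact: continuous_seg_integrable.
rewrite RintegralB//; have := integral_max_min_slope K K0 cK KD.
by lra.
Qed.

Lemma hlength_max_slope : hlength gamma =
  (\int[mu]_(phi in `[0, 2 * pi]) max_slope K phi)%:E.
Proof.
have [C HC] := max_slope_lipschitz K K0 cK KD.
have [C' HC'] := min_slope_lipschitz K K0 cK KD.
have cM := lipschitz_continuous _ _ HC; have cm := lipschitz_continuous _ _ HC'.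
have cw : continuous (fun phi => 2 * (max_slope K phi - min_slope K phi)).
  by move=> x; apply: cvgM; [exact: cvg_cst|apply: cvgB; [exact: cM|exact: cm]].
have p0 := pi_gt0 R.
apply/le_anti/andP; split.
  apply: ge_ereal_sup => _ [n [t [t0 tn tlt ->]]]; rewrite lee_fin.
  have [cS SE] := sum_hdist_integral n t t0 tn tlt.
  rewrite -(ler_pM2l (_ : 0 < 4))// -SE -integral_width.
  apply: le_Rintegral => //; [exact: continuous_seg_integrable..|].
  by move=> phi _; exact: (sum_slope_le K gamma cK cvK iK KD gammaK).
apply/lee_subgt0Pr => e e0.
(* The loss 2 (e / pi), integrated over a period 2 pi, is 4 e, which is e after division by the
   Crofton factor 4. *)
have e1 : 0 < e / pi by rewrite divr_gt0.
have [n [t [t0 tn tlt tS]]] := fine_subdivision _ e1.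
have [cS SE] := sum_hdist_integral n t t0 tn tlt.
apply: (@le_trans _ _ (\sum_(i < n) hdist (gamma (t i)) (gamma (t i.+1)))%:E); last first.
  by apply: ereal_sup_ubound; exists n, t.
rewrite -EFinB lee_fin -(ler_pM2l (_ : 0 < 4))// -SE mulrBr -integral_width.
have -> : 4 * e = \int[mu]_(phi in `[0, 2 * pi]) (2 * (e / pi)).
  have m2 : fine (mu `[0, 2 * pi]) = 2 * pi.
    by rewrite lebesgue_measure_itv/= lte_fin mulr_gt0//= subr0.
  rewrite Rintegral_cst//; have -> : 4 * e = 2 * (e / pi) * (2 * pi).
    by rewrite mulrACA divfK ?gt_eqF// -natrM.
  by rewrite -[in LHS]m2.
have cc : continuous (fun _ : R => 2 * (e / pi)) by exact: cst_continuous.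
have iw := continuous_seg_integrable _ 0 (2 * pi) cw.
have ic := continuous_seg_integrable _ 0 (2 * pi) cc.
rewrite -(RintegralB _ iw ic)//; apply: le_Rintegral => //.
- by apply: continuous_seg_integrable => x; apply: cvgB; [exact: cw|exact: cc].
- exact: continuous_seg_integrable.
- by move=> phi _; rewrite -mulrBr; exact: tS.
Qed.

End Perimeter.

Theorem theorem4p3 (R : realType) (K : set (R * R)) (gamma : R -> R * R) :
  compact K -> convex_set K -> interior K !=set0 -> K `<=` @diskD R ->
  param_boundary K gamma ->
  hlength gamma =
  (\int[lebesgue_measure]_(phi in `[0%R, (2 * pi)%R]) (sinh (r_signed K phi))%:E)%E.
Proof.
move=> cK cvK iK KD gammaK; rewrite (hlength_max_slope K gamma cK cvK iK KD gammaK).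
have K0 : K !=set0 by have [Z /interior_subset KZ] := iK; exists Z.
have [C /lipschitz_continuous cM] := max_slope_lipschitz K K0 cK KD.
rewrite /Rintegral fineK.
  by apply: eq_integral => phi _; rewrite sinh_r_signed.
by apply: integrable_fin_num => //; exact: continuous_seg_integrable.
Qed.
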